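(* Let $0<v_0<v_1$, let $f\in C_c^\infty(\mathbb{R})$ be real-valued with $\operatorname{supp} f\subset[v_0,v_1]$, and let $n\in\mathbb{N}^*$. Then there exists a constant $C>0$ (depending on $f$ and $n$ but not on $\epsilon_1$, $N$, $\omega$) such that for every $\epsilon_1>0$, every $N\in\mathbb{N}^*$ and every $\omega\in[v_0,v_1]$ the following holds. Let $u,v:[0,(4N+2)/\epsilon_1]\to\mathbb{R}$ be the controls (associated with $f,\epsilon_1,N$) defined in the context, and let $X(\omega,\cdot)$ be the solution of $$i\dot X(\omega,t)=\omega\bigl(u(t)\sigma_x+v(t)\sigma_y\bigr)X(\omega,t),\qquad X(\omega,0)=\mathbb{I},$$ on $[0,(4N+2)/\epsilon_1]$. Then $$\Bigl\|X\Bigl(\omega,\frac{4N+2}{\epsilon_1}\Bigr)-\exp\bigl(-if(\omega)\sigma_y\bigr)\Bigr\|\le C\bigl(\epsilon_1^{n}+N^{-1}\bigr).$$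
   Context: $\mathbb{N}^*=\{1,2,\dots\}$; $\mathbb{I}$ is the $2\times2$ identity matrix; $\|\cdot\|$ is the operator norm on $2\times 2$ complex matrices. Pauli matrices: $\sigma_x=\begin{pmatrix}0&1\\1&0\end{pmatrix}$, $\sigma_y=\begin{pmatrix}0&-i\\i&0\end{pmatrix}$, $\sigma_z=\begin{pmatrix}1&0\\0&-1\end{pmatrix}$. Function $g$ associated with $f$: $g:\mathbb{R}\to\mathbb{R}$ is the even smooth function determined by $\omega g(2\omega)=f(\omega)$ for all $\omega\ge 0$ (with $g(0)=0$); it is supported in $[-2v_1,-2v_0]\cup[2v_0,2v_1]$. Its unitary Fourier transform is $\hat g(t)=\frac{1}{\sqrt{2\pi}}\int_{-\infty}^{\infty}g(\omega)e^{-it\omega}\,d\omega$, which is real-valued and even. Controls associated with $f$, $\epsilon_1>0$, $N\in\mathbb{N}^*$, defined piecewise on $[0,(4N+2)/\epsilon_1]$ (values at the finitely many common endpoints of consecutive intervals are immaterial): - $u(t)=-1$, $v(t)=0$ for $t\in[0,1/\epsilon_1]$; - $u(t)=1$, $v(t)=\dfrac{\hat g(t-(4m+2)/\epsilon_1)}{2N\sqrt{2\pi}}$ for $t\in[\frac{4m+1}{\epsilon_1},\frac{4m+3}{\epsilon_1}]$, $m\in\{0,\dots,N-1\}$; - $u(t)=-1$, $v(t)=\dfrac{\hat g(t-(4m+4)/\epsilon_1)}{2N\sqrt{2\pi}}$ for $t\in[\frac{4m+3}{\epsilon_1},\frac{4m+5}{\epsilon_1}]$, $m\in\{0,\dots,N-1\}$;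 - $u(t)=1$, $v(t)=0$ for $t\in[\frac{4N+1}{\epsilon_1},\frac{4N+2}{\epsilon_1}]$. The solution $X(\omega,\cdot)$ is understood as the continuous, piecewise $C^1$ (absolutely continuous) solution with values in $2\times 2$ complex matrices. *)

(* Defs.v *)
From Stdlib Require Import Reals Factorial Lra List.
From Coquelicot Require Import Coquelicot.
Open Scope R_scope.

Definition smooth (f : R -> R) : Prop :=
  forall (k : nat) (x : R), ex_derive_n f k x.

Definition support (f : R -> R) : R -> Prop :=
  adherence (fun x => f x <> 0).

Definition Cc_infty (f : R -> R) : Prop :=
  smooth f /\ compact (support f).

Definition M2 : Type := @matrix C 2 2.

Definition mat2 (a b c d : C) : M2 := ((a, (b, tt)), ((c, (d, tt)), tt)).

Definition entry (A : M2) (i j : nat) : C := coeff_mat (RtoC 0) A i j.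

Definition Mscal (z : C) (A : M2) : M2 :=
  mk_matrix 2 2 (fun i j => Cmult z (entry A i j)).

Definition Madd (A B : M2) : M2 := @Mplus C_Ring 2 2 A B.
Definition Msub (A B : M2) : M2 := Madd A (@Mopp C_Ring 2 2 B).
Definition Mmul (A B : M2) : M2 := @Mmult C_Ring 2 2 2 A B.
Definition Mid : M2 := @Mone C_Ring 2.
Definition Mpow (A : M2) (k : nat) : M2 := @pow_n (@matrix_Ring C_Ring 2) A k.

Definition sigma_x : M2 := mat2 0%R 1%R 1%R 0%R.
Definition sigma_y : M2 := mat2 0%R (Copp Ci) Ci 0%R.

Definition vec_norm (x : @matrix C 2 1) : R :=
  sqrt (Cmod (coeff_mat (RtoC 0) x 0 0) ^ 2 + Cmod (coeff_mat (RtoC 0) x 1 0) ^ 2).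

Definition op_norm (A : M2) : R :=
  real (Lub_Rbar (fun r => exists x : @matrix C 2 1,
    vec_norm x = 1 /\ r = vec_norm (@Mmult C_Ring 2 2 1 A x))).

Definition CSeries (a : nat -> C) : C :=
  (Series (fun k => Re (a k)), Series (fun k => Im (a k))).

Definition Mexp (A : M2) : M2 :=
  mk_matrix 2 2 (fun i j =>
    CSeries (fun k => Cmult (RtoC (/ INR (fact k))) (entry (Mpow A k) i j))).

(** For [f 0 = 0] this is the only even function with [g 0 = 0] and
    [w * g (2 * w) = f w] for [w >= 0]; see [profile_even], [profile_0],
    [profile_eq] and [profile_unique]. *)
Definition profile (f : R -> R) (s : R) : R := f (Rabs s / 2) / (Rabs s / 2).

Lemma profile_even (f : R -> R) (s : R) : profile f (- s) = profile f s.
Proof. unfold profile; now rewrite Rabs_Ropp. Qed.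

Lemma profile_0 (f : R -> R) : f 0 = 0 -> profile f 0 = 0.
Proof.
  intros H; unfold profile.
  replace (Rabs 0 / 2) with 0 by (rewrite Rabs_R0; field).
  rewrite H; unfold Rdiv; apply Rmult_0_l.
Qed.

Lemma profile_eq (f : R -> R) (w : R) :
  f 0 = 0 -> 0 <= w -> w * profile f (2 * w) = f w.
Proof.
  intros H0 Hw; unfold profile.
  replace (Rabs (2 * w) / 2) with w by (rewrite Rabs_pos_eq; lra).
  destruct (Req_dec w 0) as [-> | Hn]; [rewrite H0; ring | field; exact Hn].
Qed.

Lemma profile_unique (f g : R -> R) :
  (forall s, g (- s) = g s) -> g 0 = 0 ->
  (forall w, 0 <= w -> w * g (2 * w) = f w) ->
  forall s, g s = profile f s.
Proof.
  intros He H0 Hg s.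
  assert (Hf0 : f 0 = 0) by (rewrite <- Hg; lra).
  destruct (Req_dec s 0) as [-> | Hs]; [now rewrite H0, profile_0 | ].
  assert (Ha : 0 < Rabs s) by now apply Rabs_pos_lt.
  unfold profile; rewrite <- Hg by lra.
  replace (2 * (Rabs s / 2)) with (Rabs s) by field.
  replace (g (Rabs s)) with (g s); [field; lra | ].
  unfold Rabs; destruct (Rcase_abs s); [now rewrite He | reflexivity].
Qed.

(** [cis x] is [e^(i x)]. *)
Definition cis (x : R) : C := (cos x, sin x).

Definition fourier (g : R -> R) (t : R) : C :=
  Cmult (RtoC (/ sqrt (2 * PI)))
    (@RInt_gen C_R_CompleteNormedModule
       (fun w => Cmult (RtoC (g w)) (cis (- (t * w))))
       (Rbar_locally m_infty) (Rbar_locally p_infty)).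

(** [fourier (profile f)] is real-valued, so [Re] only changes its type. *)
Definition pulse (f : R -> R) (N : nat) (s : R) : R :=
  Re (fourier (profile f) s) / (2 * INR N * sqrt (2 * PI)).

(** The intervals are open because the pieces disagree at common endpoints;
    the values of [u] and [v] there are left free. *)
Definition controls (f : R -> R) (eps : R) (N : nat) (u v : R -> R) : Prop :=
  (forall t, 0 < t < 1 / eps -> u t = -1 /\ v t = 0) /\
  (forall (m : nat) (t : R), (m < N)%nat ->
     (4 * INR m + 1) / eps < t < (4 * INR m + 3) / eps ->
     u t = 1 /\ v t = pulse f N (t - (4 * INR m + 2) / eps)) /\
  (forall (m : nat) (t : R), (m < N)%nat ->
     (4 * INR m + 3) / eps < t < (4 * INR m + 5) / eps ->
     u t = -1 /\ v t = pulse f N (t - (4 * INR m + 4) / eps)) /\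
  (forall t, (4 * INR N + 1) / eps < t < (4 * INR N + 2) / eps ->
     u t = 1 /\ v t = 0).

Definition is_derive_M2 (X : R -> M2) (t : R) (D : M2) : Prop :=
  forall i j : nat, (i < 2)%nat -> (j < 2)%nat ->
    @is_derive R_AbsRing C_R_NormedModule (fun s => entry (X s) i j) t (entry D i j).

Definition continuous_on_M2 (S : R -> Prop) (X : R -> M2) : Prop :=
  forall i j : nat, (i < 2)%nat -> (j < 2)%nat ->
    @continuous_on R_UniformSpace C_UniformSpace S (fun s => entry (X s) i j).

(** [X] is continuous on [[0, T]], starts at the identity, and satisfies
    [i X' = w (u sigma_x + v sigma_y) X] off a finite set.  For piecewise
    continuous [u], [v] this forces [X] to be piecewise [C^1]. *)
Definition is_solution (w : R) (u v : R -> R) (T : R) (X : R -> M2) : Prop :=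
  X 0 = Mid /\
  continuous_on_M2 (fun t => 0 <= t <= T) X /\
  exists exceptional : list R,
    forall t, 0 < t < T -> ~ In t exceptional ->
      exists D : M2,
        is_derive_M2 X t D /\
        Mscal Ci D =
          Mmul (Mscal (RtoC w)
                  (Madd (Mscal (RtoC (u t)) sigma_x) (Mscal (RtoC (v t)) sigma_y)))
               (X t).

(* Main.v *)
(** In the frame rotating with [omega * u * sigma_x] the generator becomes
    [omega v(t) (cos (2 omega s) sigma_y -+ sin (2 omega s) sigma_z)], where [s] is
    the time measured from the centre of the current interval, at which the
    integral of [u] vanishes. The pulse is even, so on each of the [2N] intervals
    the [sigma_z] part has zero mean and the [sigma_y] part has the integral [phi];
    as the pulse has mass [O(1/N)], one interval acts as the rotation by [phi] up
    to [O(1/N^2)], and all of them as the rotation by [Phi = 2N phi] up to [O(1/N)].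
    [Phi] is the Fourier inversion integral of [omega g(2 omega) = f(omega)]
    truncated at [1/eps]; inversion is obtained by damping with [e^(-d s)], which
    turns the Dirichlet kernel into an explicit smooth one, and letting [d -> 0].
    The rapid decay of the transform of a smooth function makes the truncation
    error [O(eps^n)]. *)

Require Import Defs.
From Stdlib Require Import Reals Factorial Lra Lia List Nsatz.
From Coquelicot Require Import Coquelicot.
Open Scope R_scope.

(** * Increments of functions differentiable off a finite set *)

(** The difficulty is uniformity in [eps] and [omega]. The drive over one interval must be bounded
    independently of the length [2 / eps]: two integrations by parts bound the transform by
    [M / (1 + s^2)], and the increment of [M atan s] stays below [M PI] on every interval. The
    errors of the [2N] intervals add up instead of compounding, because the exact solution keeps its
    norm and rotations do not amplify errors. No error arises between intervals: the frames centred
    in two consecutive intervals coincide at the common endpoint, since [u] changes sign there. In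
    the inversion, the errors that vanish with [d] may depend on [omega] and on [1 / eps], which
    stay fixed while [d -> 0]; only the tail beyond [1 / eps] survives, and its constant comes from
    integrations by parts alone. Estimates compare a function with a primitive whose derivative
    dominates its own. This tolerates controls that are arbitrary at finitely many points, and lets
    a derivative in the upper limit replace an exchange of integrals. *)

Lemma is_derive_continuity_pt (F : R -> R) (t d : R) :
  is_derive F t d -> continuity_pt F t.
Proof.
  intros H; apply continuity_pt_filterlim.
  apply (ex_derive_continuous F t); now exists d.
Qed.

Lemma is_derive_Rminus (f g : R -> R) (x df dg : R) :
  is_derive f x df -> is_derive g x dg -> is_derive (fun t => f t - g t) x (df - dg).
Proof. exact (is_derive_minus f g x df dg). Qed.

Lemma is_derive_Ropp (f : R -> R) (x df : R) :
  is_derive f x df -> is_derive (fun t => - f t) x (- df).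
Proof. exact (is_derive_opp f x df). Qed.

Lemma is_derive_Rscal (k : R) (f : R -> R) (x df : R) :
  is_derive f x df -> is_derive (fun t => k * f t) x (k * df).
Proof. exact (is_derive_scal f x k df). Qed.

(** Induction on the exceptional list: a listed point outside [(a, b)] is dropped, and one inside
    splits the interval. Continuity at that point makes the mean value theorem available on both
    halves. *)
Lemma nonincreasing_off_finite (F : R -> R) (l : list R) : forall a b : R,
  a <= b -> (forall t, continuity_pt F t) ->
  (forall t, a < t < b -> ~ In t l -> exists d, is_derive F t d /\ d <= 0) ->
  F b <= F a.
Proof.
  induction l as [| x l IH]; intros a b Hab Hc Hd.
  - (* [MVT_gen] may return an endpoint, where nothing is known of [Derive F] *)
    destruct (MVT_gen F a b (fun t => Rmin (Derive F t) 0)) as [c [_ Heq]].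
    + rewrite Rmin_left, Rmax_right by lra; intros t Ht.
      destruct (Hd t Ht (fun H => H)) as [d [Hd1 Hd2]].
      now rewrite (is_derive_unique _ _ _ Hd1), Rmin_left.
    + intros t _; apply Hc.
    + assert (Rmin (Derive F c) 0 <= 0) by apply Rmin_r.
      nra.
  - destruct (Rle_or_lt x a) as [Hx | Hx]; [| destruct (Rle_or_lt b x) as [Hx' | Hx']].
    + apply IH; try easy; intros t Ht Hn; apply Hd; [easy |].
      intros [-> | H]; [lra | easy].
    + apply IH; try easy; intros t Ht Hn; apply Hd; [easy |].
      intros [-> | H]; [lra | easy].
    + apply Rle_trans with (F x); apply IH; try easy; try lra;
        intros t Ht Hn; apply Hd; try lra; intros [-> | H]; try easy; lra.
Qed.

(** Both [F - G] and [- F - G] are nonincreasing. This stands in for integrating the derivative of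
    [F], so nothing is asked at the exceptional points beyond continuity. *)
Lemma Rabs_increment_le_off_finite (F G : R -> R) (l : list R) (a b : R) :
  a <= b -> (forall t, continuity_pt F t) -> (forall t, continuity_pt G t) ->
  (forall t, a < t < b -> ~ In t l ->
     exists d e, is_derive F t d /\ is_derive G t e /\ Rabs d <= e) ->
  Rabs (F b - F a) <= G b - G a.
Proof.
  intros Hab HF HG Hd; apply Rabs_le; split.
  - assert (- F b - G b <= - F a - G a); [| lra].
    apply (nonincreasing_off_finite (fun t => - F t - G t) l a b Hab).
    + intros t; apply continuity_pt_minus; [now apply continuity_pt_opp | easy].
    + intros t Ht Hn; destruct (Hd t Ht Hn) as (d & e & H1 & H2 & H3).
      exists (- d - e); split.
      * apply is_derive_Rminus; [now apply is_derive_Ropp | easy].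
      * apply Rabs_le_between in H3; lra.
  - assert (F b - G b <= F a - G a); [| lra].
    apply (nonincreasing_off_finite (fun t => F t - G t) l a b Hab).
    + intros t; now apply continuity_pt_minus.
    + intros t Ht Hn; destruct (Hd t Ht Hn) as (d & e & H1 & H2 & H3).
      exists (d - e); split; [now apply is_derive_Rminus |].
      apply Rabs_le_between in H3; lra.
Qed.

(** Nothing is assumed outside [[a, b]], so [G] may be singular elsewhere, as the primitive
    [- C / s ^ n] used for the tail is at [0]. *)
Lemma Rabs_increment_le (F G f g : R -> R) (a b : R) :
  a <= b -> (forall t, a <= t <= b -> is_derive F t (f t)) ->
  (forall t, a <= t <= b -> is_derive G t (g t)) ->
  (forall t, a <= t <= b -> Rabs (f t) <= g t) ->
  Rabs (F b - F a) <= G b - G a.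
Proof.
  intros Hab HF HG Hfg.
  assert (H : forall s, s = 1 \/ s = -1 -> s * (F b - F a) <= G b - G a).
  { intros s Hs.
    assert (Hd : forall t, a <= t <= b ->
      is_derive (fun t => s * F t - G t) t (s * f t - g t)).
    { intros t Ht; apply (is_derive_Rminus (fun t => s * F t) G); [| now apply HG].
      apply is_derive_Rscal; now apply HF. }
    destruct (MVT_gen (fun t => s * F t - G t) a b (fun t => s * f t - g t))
      as [c [Hc Heq]].
    - rewrite Rmin_left, Rmax_right by easy; intros t Ht; apply Hd; lra.
    - rewrite Rmin_left, Rmax_right by easy; intros t Ht.
      apply (is_derive_continuity_pt _ t _ (Hd t Ht)).
    - rewrite Rmin_left, Rmax_right in Hc by easy.
      assert (Hfc := Hfg c Hc); apply Rabs_le_between in Hfc.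
      assert (s * f c - g c <= 0) by (destruct Hs as [-> | ->]; lra).
      nra. }
  apply Rabs_le; split.
  - assert (H1 := H (-1) (or_intror eq_refl)); lra.
  - assert (H1 := H 1 (or_introl eq_refl)); lra.
Qed.

Lemma Rabs_comb2_le (c s y z K : R) :
  Rabs c <= 1 -> Rabs s <= 1 -> Rabs y <= K -> Rabs z <= K ->
  Rabs (c * y + s * z) <= 2 * K.
Proof.
  intros Hc Hs Hy Hz; apply Rle_trans with (1 := Rabs_triang _ _).
  rewrite !Rabs_mult.
  assert (0 <= Rabs c) by apply Rabs_pos; assert (0 <= Rabs s) by apply Rabs_pos.
  assert (0 <= Rabs y) by apply Rabs_pos; assert (0 <= Rabs z) by apply Rabs_pos.
  nra.
Qed.

(** * Averaging of a component driven by a small oscillating term *)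

Section Averaging.

Variables (x y : R) (l : list R) (r C S W w Y z1 z2 : R -> R) (K : R).
Hypothesis Hxy : x <= y.
Hypothesis HY : forall t, continuity_pt Y t.
Hypothesis HW : forall t, is_derive W t (w t).
Hypothesis Hr : forall t, x < t < y -> Rabs (r t) <= w t.
Hypothesis HC : forall t, Rabs (C t) <= 1.
Hypothesis HS : forall t, Rabs (S t) <= 1.
Hypothesis HdY : forall t, x < t < y -> ~ In t l ->
  is_derive Y t (r t * (C t * z1 t + S t * z2 t)).

Lemma driven_increment_le :
  (forall t, x < t < y -> Rabs (z1 t) <= K /\ Rabs (z2 t) <= K) ->
  forall t, x <= t <= y -> Rabs (Y t - Y x) <= 2 * K * (W t - W x).
Proof.
  intros Hz t Ht.
  replace (2 * K * (W t - W x)) with (2 * K * W t - 2 * K * W x) by ring.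
  apply (Rabs_increment_le_off_finite Y (fun t => 2 * K * W t) l); try easy.
  - intros u; apply (is_derive_continuity_pt _ u (2 * K * w u)).
    apply (is_derive_Rscal (2 * K) W), HW.
  - intros u Hu Hn.
    exists (r u * (C u * z1 u + S u * z2 u)), (2 * K * w u); split; [| split].
    + apply HdY; [lra | easy].
    + apply (is_derive_Rscal (2 * K) W), HW.
    + rewrite Rabs_mult.
      assert (Rabs (r u) <= w u) by (apply Hr; lra).
      assert (Rabs (C u * z1 u + S u * z2 u) <= 2 * K)
        by (apply Rabs_comb2_le; try easy; apply Hz; lra).
      assert (0 <= Rabs (r u)) by apply Rabs_pos.
      assert (0 <= Rabs (C u * z1 u + S u * z2 u)) by apply Rabs_pos.
      nra.
Qed.

(* Freezing [z1], [z2] at their initial values costs only the square of the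
   total variation [W] of the drive. *)
Lemma driven_average (V1 V2 : R -> R) :
  W x = 0 -> (forall t, x <= t <= y -> 0 <= W t) ->
  (forall t, is_derive V1 t (r t * C t)) ->
  (forall t, is_derive V2 t (r t * S t)) ->
  (forall t, x <= t <= y ->
     Rabs (z1 t - z1 x) <= K * W t /\ Rabs (z2 t - z2 x) <= K * W t) ->
  Rabs (Y y - Y x - z1 x * (V1 y - V1 x) - z2 x * (V2 y - V2 x)) <= K * W y ^ 2.
Proof.
  intros HW0 HWpos HV1 HV2 Hz.
  replace (K * W y ^ 2) with (K * W y ^ 2 - K * W x ^ 2) by (rewrite HW0; ring).
  replace (Y y - Y x - z1 x * (V1 y - V1 x) - z2 x * (V2 y - V2 x))
    with ((Y y - z1 x * V1 y - z2 x * V2 y) - (Y x - z1 x * V1 x - z2 x * V2 x)) by ring.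
  assert (HdW2 : forall u, is_derive (fun t => K * W t ^ 2) u (2 * K * W u * w u)).
  { intros u; assert (HWu := HW u); assert (ex_derive W u) by (now exists (w u)).
    auto_derive; [easy |]. replace (Derive (fun t => W t) u) with (w u); [ring |].
    symmetry; now apply is_derive_unique. }
  (* [K W^2] has derivative [2 K W w], which is [w >= |r|] times the bound [2 (K W)] of the
     oscillating combination of the increments of [z1] and [z2]. *)
  apply (Rabs_increment_le_off_finite
           (fun t => Y t - z1 x * V1 t - z2 x * V2 t) (fun t => K * W t ^ 2) l x y Hxy).
  - intros t; apply continuity_pt_minus; [apply continuity_pt_minus; [easy |] |].
    + apply (is_derive_continuity_pt _ t (z1 x * (r t * C t))).
      apply (is_derive_Rscal (z1 x) V1), HV1.
    + apply (is_derive_continuity_pt _ t (z2 x * (r t * S t))).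
      apply (is_derive_Rscal (z2 x) V2), HV2.
  - intros t; apply (is_derive_continuity_pt _ t _ (HdW2 t)).
  - intros t Ht Hn.
    exists (r t * (C t * z1 t + S t * z2 t) - z1 x * (r t * C t) - z2 x * (r t * S t)),
      (2 * K * W t * w t); split; [| split; [apply HdW2 |]].
    + apply (is_derive_Rminus (fun t => Y t - z1 x * V1 t) (fun t => z2 x * V2 t));
        [apply (is_derive_Rminus Y (fun t => z1 x * V1 t)) |]; [now apply HdY | |].
      * apply (is_derive_Rscal (z1 x) V1), HV1.
      * apply (is_derive_Rscal (z2 x) V2), HV2.
    + replace (r t * (C t * z1 t + S t * z2 t) - z1 x * (r t * C t) - z2 x * (r t * S t))
        with (r t * (C t * (z1 t - z1 x) + S t * (z2 t - z2 x))) by ring.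
      rewrite Rabs_mult.
      assert (Rabs (r t) <= w t) by (apply Hr; lra).
      assert (Rabs (C t * (z1 t - z1 x) + S t * (z2 t - z2 x)) <= 2 * (K * W t))
        by (apply Rabs_comb2_le; try easy; apply Hz; lra).
      assert (0 <= Rabs (r t)) by apply Rabs_pos.
      assert (0 <= Rabs (C t * (z1 t - z1 x) + S t * (z2 t - z2 x))) by apply Rabs_pos.
      nra.
Qed.

End Averaging.

(** * Euler steps and rotations *)

Lemma Rabs_cos_le_1 (x : R) : Rabs (cos x) <= 1.
Proof. apply Rabs_le, COS_bound. Qed.

Lemma Rabs_sin_le_1 (x : R) : Rabs (sin x) <= 1.
Proof. apply Rabs_le, SIN_bound. Qed.

Lemma lipschitz_of_derive (F f : R -> R) (M x y : R) :
  (forall t, is_derive F t (f t)) ->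
  (forall t, Rmin x y <= t <= Rmax x y -> Rabs (f t) <= M) ->
  Rabs (F x - F y) <= M * Rabs (x - y).
Proof.
  intros HF Hf.
  destruct (MVT_gen F y x f) as [c [Hc ->]].
  - intros; apply HF.
  - intros t _; apply (is_derive_continuity_pt F t (f t)), HF.
  - rewrite Rabs_mult; apply Rmult_le_compat_r; [apply Rabs_pos |].
    apply Hf; now rewrite Rmin_comm, Rmax_comm.
Qed.

Lemma cos_lipschitz (x y : R) : Rabs (cos x - cos y) <= Rabs (x - y).
Proof.
  rewrite <- (Rmult_1_l (Rabs (x - y))).
  apply (lipschitz_of_derive cos (fun t => - sin t)).
  - intros t; apply is_derive_cos.
  - intros t _; rewrite Rabs_Ropp; apply Rabs_sin_le_1.
Qed.

Lemma sin_lipschitz (x y : R) : Rabs (sin x - sin y) <= Rabs (x - y).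
Proof.
  rewrite <- (Rmult_1_l (Rabs (x - y))).
  apply (lipschitz_of_derive sin cos).
  - intros t; apply is_derive_sin.
  - intros t _; apply Rabs_cos_le_1.
Qed.

Lemma Rabs_sin_le (x : R) : Rabs (sin x) <= Rabs x.
Proof.
  replace (sin x) with (sin x - sin 0) by (rewrite sin_0; ring).
  replace (Rabs x) with (Rabs (x - 0)) by (f_equal; ring).
  apply sin_lipschitz.
Qed.

Lemma Rabs_sub_1_cos_le (x : R) : Rabs (cos x - 1) <= x ^ 2.
Proof.
  replace (cos x - 1) with (- (2 * sin (x / 2) ^ 2)).
  - assert (H := Rabs_sin_le (x / 2)); apply Rsqr_le_abs_1 in H; unfold Rsqr in H.
    rewrite Rabs_Ropp, Rabs_pos_eq; nra.
  - replace (cos x) with (cos (2 * (x / 2))) by (f_equal; field).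
    rewrite cos_2a_sin; ring.
Qed.

(** The derivative of [x cos x - sin x] is [- x sin x], at most [|x|] in modulus between [0] and
    [x]. *)
Lemma Rabs_sin_sub_mul_cos_le (x : R) : Rabs (x * cos x - sin x) <= x ^ 2.
Proof.
  replace (x * cos x - sin x) with ((x * cos x - sin x) - (0 * cos 0 - sin 0))
    by (rewrite sin_0; ring).
  replace (x ^ 2) with (Rabs x * Rabs (x - 0)).
  - apply (lipschitz_of_derive (fun x => x * cos x - sin x) (fun x => - (x * sin x))).
    + intros t; auto_derive; [easy | ring].
    + intros t Ht; rewrite Rabs_Ropp, Rabs_mult.
      assert (Rabs t <= Rabs x).
      { unfold Rmin, Rmax in Ht; destruct (Rle_dec x 0).
        - rewrite !Rabs_left1; lra.
        - rewrite !Rabs_pos_eq; lra. }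
      assert (H1 := Rabs_sin_le_1 t); assert (H2 := Rabs_pos t); nra.
  - replace (x - 0) with x by ring; rewrite <- Rabs_mult.
    replace (x * x) with (x ^ 2) by ring; apply Rabs_pos_eq, pow2_ge_0.
Qed.

(* One Euler step of [x' = y, y' = -x], followed by the exact backward rotation. *)
Lemma euler_step_vs_rotation (phi E K x y x' y' : R) :
  Rabs x <= K -> Rabs y <= K ->
  Rabs (x' - x - phi * y) <= E -> Rabs (y' - y + phi * x) <= E ->
  Rabs (cos phi * x' - sin phi * y' - x) <= 3 * K * phi ^ 2 + 2 * E /\
  Rabs (sin phi * x' + cos phi * y' - y) <= 3 * K * phi ^ 2 + 2 * E.
Proof.
  intros Hx Hy H1 H2.
  assert (0 <= Rabs x) by apply Rabs_pos; assert (0 <= Rabs y) by apply Rabs_pos.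
  assert (Hp : 0 <= phi ^ 2) by apply pow2_ge_0.
  (* After the backward rotation the coefficients left over are, up to sign,
     [cos phi - 1 + phi sin phi] and [phi cos phi - sin phi]. The first-order terms cancel, leaving
     at most [2 phi^2] and [phi^2]; hence the [3]. *)
  assert (Hc : Rabs (cos phi - 1 + phi * sin phi) <= 2 * phi ^ 2).
  { apply Rle_trans with (1 := Rabs_triang _ _).
    assert (Hs := Rabs_sub_1_cos_le phi).
    assert (Rabs (phi * sin phi) <= phi ^ 2); [| lra].
    rewrite Rabs_mult, <- (Rabs_pos_eq (phi ^ 2)), <- RPow_abs by easy.
    assert (Hq := Rabs_sin_le phi); assert (Hr := Rabs_pos phi); nra. }
  assert (Hs := Rabs_sin_sub_mul_cos_le phi).
  set (e1 := x' - x - phi * y) in *; set (e2 := y' - y + phi * x) in *.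
  assert (HE : Rabs (cos phi * e1 + - sin phi * e2) <= 2 * E).
  { apply Rabs_comb2_le; try easy; [apply Rabs_cos_le_1 |].
    rewrite Rabs_Ropp; apply Rabs_sin_le_1. }
  assert (HE' : Rabs (sin phi * e1 + cos phi * e2) <= 2 * E)
    by (apply Rabs_comb2_le; try easy; [apply Rabs_sin_le_1 | apply Rabs_cos_le_1]).
  assert (Hmul : forall a b u v, Rabs a <= u -> Rabs b <= v -> Rabs (a * b) <= u * v).
  { intros a b u v Ha Hb; rewrite Rabs_mult; apply Rmult_le_compat; auto using Rabs_pos. }
  split.
  - replace (cos phi * x' - sin phi * y' - x) with
      ((cos phi - 1 + phi * sin phi) * x + (phi * cos phi - sin phi) * y
       + (cos phi * e1 + - sin phi * e2)) by (unfold e1, e2; ring).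
    apply Rle_trans with (1 := Rabs_triang _ _), Rplus_le_compat; [| easy].
    apply Rle_trans with (1 := Rabs_triang _ _).
    assert (Ha := Hmul _ _ _ _ Hc Hx); assert (Hb := Hmul _ _ _ _ Hs Hy); lra.
  - replace (sin phi * x' + cos phi * y' - y) with
      ((cos phi - 1 + phi * sin phi) * y + - (phi * cos phi - sin phi) * x
       + (sin phi * e1 + cos phi * e2)) by (unfold e1, e2; ring).
    apply Rle_trans with (1 := Rabs_triang _ _), Rplus_le_compat; [| easy].
    apply Rle_trans with (1 := Rabs_triang _ _).
    rewrite <- Rabs_Ropp in Hs.
    assert (Ha := Hmul _ _ _ _ Hc Hy); assert (Hb := Hmul _ _ _ _ Hs Hx); lra.
Qed.

(** The state after [k] steps, rotated back by [k phi], moves at each step only by the one-step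
    error, itself rotated. Components are estimated one by one, so a rotation costs a factor [2]:
    once when the step error is rotated back, once when the final state is rotated forward, hence
    [4 n]. The bound [K] on all iterates is a hypothesis, so the errors do not feed on
    themselves. *)
Lemma euler_steps_vs_rotation (phi E K : R) (x y : nat -> R) (n : nat) :
  (forall k, (k <= n)%nat -> Rabs (x k) <= K /\ Rabs (y k) <= K) ->
  (forall k, (k < n)%nat ->
     Rabs (x (S k) - x k - phi * y k) <= E /\ Rabs (y (S k) - y k + phi * x k) <= E) ->
  Rabs (x n - (cos (INR n * phi) * x 0%nat + sin (INR n * phi) * y 0%nat))
    <= 4 * INR n * (3 * K * phi ^ 2 + 2 * E) /\
  Rabs (y n - (cos (INR n * phi) * y 0%nat - sin (INR n * phi) * x 0%nat))
    <= 4 * INR n * (3 * K * phi ^ 2 + 2 * E).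
Proof.
  intros HK HE.
  set (Q := 3 * K * phi ^ 2 + 2 * E).
  assert (H : forall k, (k <= n)%nat ->
    Rabs (cos (INR k * phi) * x k - sin (INR k * phi) * y k - x 0%nat) <= 2 * INR k * Q /\
    Rabs (sin (INR k * phi) * x k + cos (INR k * phi) * y k - y 0%nat) <= 2 * INR k * Q).
  { induction k as [| k IH]; intros Hk.
    - replace (INR 0 * phi) with 0 by (simpl; ring); rewrite cos_0, sin_0.
      replace (1 * x 0%nat - 0 * y 0%nat - x 0%nat) with 0 by ring.
      replace (0 * x 0%nat + 1 * y 0%nat - y 0%nat) with 0 by ring.
      rewrite Rabs_R0; simpl; lra.
    - destruct IH as [I1 I2]; [lia |].
      destruct (HK k) as [K1 K2]; [lia |]; destruct (HE k Hk) as [E1 E2].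
      destruct (euler_step_vs_rotation phi E K _ _ _ _ K1 K2 E1 E2) as [S1 S2].
      fold Q in S1, S2; rewrite S_INR.
      replace ((INR k + 1) * phi) with (INR k * phi + phi) by ring.
      rewrite cos_plus, sin_plus.
      set (c := cos (INR k * phi)) in *; set (s := sin (INR k * phi)) in *.
      set (c' := cos phi) in *; set (s' := sin phi) in *.
      assert (Hc : Rabs c <= 1) by apply Rabs_cos_le_1.
      assert (Hs : Rabs s <= 1) by apply Rabs_sin_le_1.
      assert (Hs' : Rabs (- s) <= 1) by (now rewrite Rabs_Ropp).
      split.
      + replace ((c * c' - s * s') * x (S k) - (s * c' + c * s') * y (S k) - x 0%nat) with
          ((c * x k - s * y k - x 0%nat)
           + (c * (c' * x (S k) - s' * y (S k) - x k)
              + - s * (s' * x (S k) + c' * y (S k) - y k))) by ring.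
        apply Rle_trans with (1 := Rabs_triang _ _).
        assert (H := Rabs_comb2_le _ _ _ _ _ Hc Hs' S1 S2); lra.
      + replace ((s * c' + c * s') * x (S k) + (c * c' - s * s') * y (S k) - y 0%nat) with
          ((s * x k + c * y k - y 0%nat)
           + (s * (c' * x (S k) - s' * y (S k) - x k)
              + c * (s' * x (S k) + c' * y (S k) - y k))) by ring.
        apply Rle_trans with (1 := Rabs_triang _ _).
        assert (H := Rabs_comb2_le _ _ _ _ _ Hs Hc S1 S2); lra. }
  destruct (H n (Nat.le_refl n)) as [H1 H2]; clear H.
  set (psi := INR n * phi) in *.
  assert (Hcs := sin2_cos2 psi); unfold Rsqr in Hcs.
  assert (Hc := Rabs_cos_le_1 psi); assert (Hs := Rabs_sin_le_1 psi).
  assert (Hs' : Rabs (- sin psi) <= 1) by (now rewrite Rabs_Ropp).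
  split.
  - replace (x n - (cos psi * x 0%nat + sin psi * y 0%nat)) with
      (cos psi * (cos psi * x n - sin psi * y n - x 0%nat)
       + sin psi * (sin psi * x n + cos psi * y n - y 0%nat))
      by (rewrite <- (Rmult_1_l (x n)) at 3; rewrite <- Hcs; ring).
    assert (H := Rabs_comb2_le _ _ _ _ _ Hc Hs H1 H2); lra.
  - replace (y n - (cos psi * y 0%nat - sin psi * x 0%nat)) with
      (- sin psi * (cos psi * x n - sin psi * y n - x 0%nat)
       + cos psi * (sin psi * x n + cos psi * y n - y 0%nat))
      by (rewrite <- (Rmult_1_l (y n)) at 3; rewrite <- Hcs; ring).
    assert (H := Rabs_comb2_le _ _ _ _ _ Hs' Hc H1 H2); lra.
Qed.

(** * The rotating frame *)

Lemma is_derive_shift (F : R -> R) (c t d : R) :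
  is_derive F (t - c) d -> is_derive (fun s => F (s - c)) t d.
Proof.
  intros H.
  replace d with (1 * d) by ring.
  apply (is_derive_comp F (fun s => s - c) t d 1 H).
  auto_derive; [easy | ring].
Qed.

Lemma is_derive_val (F : R -> R) (t d d' : R) :
  is_derive F t d -> d = d' -> is_derive F t d'.
Proof. now intros H <-. Qed.

(** The real part of [e^(i k (t - c)) (f + i g)]; its imaginary part is [rot (- k) c g f]. *)
Definition rot (k c : R) (f g : R -> R) (t : R) : R :=
  cos (k * (t - c)) * f t - sin (k * (t - c)) * g t.

Lemma is_derive_rot (k c t df dg : R) (f g : R -> R) :
  is_derive f t df -> is_derive g t dg ->
  is_derive (rot k c f g) t
    (cos (k * (t - c)) * (df - k * g t) - sin (k * (t - c)) * (dg + k * f t)).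
Proof.
  intros Hf Hg; unfold rot.
  assert (ex_derive f t) by (now exists df); assert (ex_derive g t) by (now exists dg).
  auto_derive; [easy |].
  replace (Derive (fun x => f x) t) with df by (symmetry; now apply is_derive_unique).
  replace (Derive (fun x => g x) t) with dg by (symmetry; now apply is_derive_unique).
  unfold Rminus; ring.
Qed.

Lemma continuity_pt_rot (k c : R) (f g : R -> R) :
  (forall t, continuity_pt f t) -> (forall t, continuity_pt g t) ->
  forall t, continuity_pt (rot k c f g) t.
Proof.
  intros Hf Hg t; apply continuity_pt_minus; apply continuity_pt_mult; try easy.
  - apply (is_derive_continuity_pt (fun t => cos (k * (t - c))) t (- k * sin (k * (t - c)))).
    auto_derive; [easy | unfold Rminus; ring].
  - apply (is_derive_continuity_pt (fun t => sin (k * (t - c))) t (k * cos (k * (t - c)))).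
    auto_derive; [easy | unfold Rminus; ring].
Qed.

Section Flow.

(* A solution column [(p, q)] is written as [al = p + q], [be = p - q], the
   coordinates in which [sigma_x] is diagonal; [1] and [2] are real and imaginary
   parts. *)
Variables (w T : R) (al1 al2 be1 be2 u v : R -> R) (l : list R).
Hypothesis Cal1 : forall t, continuity_pt al1 t.
Hypothesis Cal2 : forall t, continuity_pt al2 t.
Hypothesis Cbe1 : forall t, continuity_pt be1 t.
Hypothesis Cbe2 : forall t, continuity_pt be2 t.
Hypothesis Hflow : forall t, 0 < t < T -> ~ In t l ->
  is_derive al1 t (w * u t * al2 t + w * v t * be1 t) /\
  is_derive al2 t (- (w * u t * al1 t) + w * v t * be2 t) /\
  is_derive be1 t (- (w * u t * be2 t) - w * v t * al1 t) /\
  is_derive be2 t (w * u t * be1 t - w * v t * al2 t).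
Hypothesis Hinit : al1 0 ^ 2 + al2 0 ^ 2 + be1 0 ^ 2 + be2 0 ^ 2 = 2.

(** The system is skew: in the derivative of the sum of squares the [u] terms cancel within [al] and
    within [be], the [v] terms between [al] and [be]. The value [2] is twice the squared norm of a
    unit column. *)
Lemma flow_norm (t : R) : 0 <= t <= T ->
  al1 t ^ 2 + al2 t ^ 2 + be1 t ^ 2 + be2 t ^ 2 = 2.
Proof.
  intros Ht.
  pose (F := fun t => al1 t ^ 2 + al2 t ^ 2 + be1 t ^ 2 + be2 t ^ 2).
  assert (H : Rabs (F t - F 0) <= 0 - 0).
  { apply (Rabs_increment_le_off_finite F (fun _ => 0) l 0 t); [easy | | |].
    - assert (Hsq : forall f s, continuity_pt f s -> continuity_pt (fun s => f s ^ 2) s).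
      { intros f s Hf; apply continuity_pt_filterlim.
        apply (continuous_comp f (fun x => x ^ 2)); [now apply continuity_pt_filterlim |].
        apply (ex_derive_continuous (fun x => x ^ 2)); now auto_derive. }
      intros s; unfold F; repeat apply (continuity_pt_plus (fun _ => _)); auto.
    - intros s; now apply continuity_pt_const.
    - intros s Hs Hn; destruct (Hflow s) as (H1 & H2 & H3 & H4); [lra | easy |].
      exists 0, 0; split; [| split; [apply (is_derive_const 0 s) | rewrite Rabs_R0; lra]].
      unfold F.
      assert (ex_derive al1 s) by (eexists; exact H1).
      assert (ex_derive al2 s) by (eexists; exact H2).
      assert (ex_derive be1 s) by (eexists; exact H3).
      assert (ex_derive be2 s) by (eexists; exact H4).
      auto_derive; [easy |].
      replace (Derive (fun x => al1 x) s) with (w * u s * al2 s + w * v s * be1 s)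
        by (symmetry; now apply is_derive_unique).
      replace (Derive (fun x => al2 x) s) with (- (w * u s * al1 s) + w * v s * be2 s)
        by (symmetry; now apply is_derive_unique).
      replace (Derive (fun x => be1 x) s) with (- (w * u s * be2 s) - w * v s * al1 s)
        by (symmetry; now apply is_derive_unique).
      replace (Derive (fun x => be2 x) s) with (w * u s * be1 s - w * v s * al2 s)
        by (symmetry; now apply is_derive_unique).
      ring. }
  assert (F t - F 0 = 0).
  { destruct (Req_dec (F t - F 0) 0) as [-> | Hne]; [easy |].
    apply Rabs_pos_lt in Hne; lra. }
  unfold F in *; lra.
Qed.

Lemma flow_bound (t : R) : 0 <= t <= T ->
  Rabs (al1 t) <= 2 /\ Rabs (al2 t) <= 2 /\ Rabs (be1 t) <= 2 /\ Rabs (be2 t) <= 2.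
Proof.
  intros Ht; assert (H := flow_norm t Ht).
  repeat split; apply Rabs_le; nra.
Qed.

Lemma rot_bound (k c t : R) (f g : R -> R) :
  Rabs (f t) <= 2 -> Rabs (g t) <= 2 -> Rabs (rot k c f g t) <= 4.
Proof.
  intros Hf Hg; unfold rot.
  replace (cos (k * (t - c)) * f t - sin (k * (t - c)) * g t)
    with (cos (k * (t - c)) * f t + - sin (k * (t - c)) * g t) by ring.
  replace 4 with (2 * 2) by ring.
  apply Rabs_comb2_le; try easy; [apply Rabs_cos_le_1 |].
  rewrite Rabs_Ropp; apply Rabs_sin_le_1.
Qed.

Section Piece.

Variables (kap c A : R).
Hypothesis Hkap : kap = 1 \/ kap = -1.
Hypothesis HA : 0 < A.

Let a1 := rot (kap * w) c al1 al2.
Let a2 := rot (- (kap * w)) c al2 al1.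
Let b1 := rot (- (kap * w)) c be1 be2.
Let b2 := rot (kap * w) c be2 be1.

(** In complex form, with [th = kap w (t - c)], the system is [al' = - i w u al + w v be] and
    [be' = i w u be - w v al]. For [a = e^(i th) al] and [b = e^(- i th) be] the [u] terms drop out,
    leaving [a' = w v e^(2 i th) b] and [b' = - w v e^(- 2 i th) a], where
    [e^(2 i th) = C + i S]. *)
Lemma is_derive_frame (t : R) : 0 < t < T -> ~ In t l -> u t = kap ->
  let C := cos (2 * w * (t - c)) in let S := kap * sin (2 * w * (t - c)) in
  is_derive a1 t (w * v t * (C * b1 t + - S * b2 t)) /\
  is_derive a2 t (w * v t * (C * b2 t + S * b1 t)) /\
  is_derive b1 t (w * v t * (- C * a1 t + - S * a2 t)) /\
  is_derive b2 t (w * v t * (- C * a2 t + S * a1 t)).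
Proof.
  intros Ht Hn Hu C S; destruct (Hflow t Ht Hn) as (H1 & H2 & H3 & H4).
  rewrite Hu in H1, H2, H3, H4.
  set (th := kap * w * (t - c)).
  assert (HC : C = 1 - 2 * sin th * sin th).
  { unfold C, th; rewrite <- cos_2a_sin.
    destruct Hkap as [-> | ->]; [f_equal; ring |].
    rewrite <- cos_neg; f_equal; ring. }
  assert (HS : S = 2 * sin th * cos th).
  { unfold S, th; rewrite <- sin_2a.
    destruct Hkap as [-> | ->];
      [rewrite Rmult_1_l; f_equal; ring |].
    replace (2 * w * (t - c)) with (- (2 * (-1 * w * (t - c)))) by ring.
    rewrite sin_neg; ring. }
  assert (Hcs := sin2_cos2 th); unfold Rsqr in Hcs.
  assert (Hth : - (kap * w) * (t - c) = - th) by (unfold th; ring).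
  rewrite HC, HS; clear C S HC HS; unfold a1, a2, b1, b2.
  split; [| split; [| split]].
  all: eapply is_derive_val; [apply is_derive_rot; eassumption |].
  all: unfold rot; rewrite ?Hth, ?cos_neg, ?sin_neg; fold th;
       set (C := cos th) in *; set (S := sin th) in *; clearbody C S; clear - Hcs; nsatz.
Qed.

(* [phi] is the same for both signs of [kap]: the drive [q] is even, so only
   its cosine moment survives. *)
Variables (q P Q G g : R -> R) (phi : R).
Hypothesis HAT : 0 <= c - A /\ c + A <= T.
Hypothesis Hu : forall t, c - A < t < c + A -> u t = kap /\ w * v t = q (t - c).
Hypothesis HP : forall s, is_derive P s (q s * cos (2 * w * s)).
Hypothesis HQ : forall s, is_derive Q s (q s * sin (2 * w * s)).
Hypothesis HG : forall s, is_derive G s (g s).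
Hypothesis Hqg : forall s, Rabs (q s) <= g s.
Hypothesis Hphi : phi = P A - P (- A).
Hypothesis HQA : Q (- A) = Q A.

(** The four frame equations differ only in the signs [sg] of the cosine and [tau] of the sine, so
    one statement covers them. The sign [tau], which carries [kap], leaves no trace because the sine
    moment of an even drive is zero. *)
Lemma frame_component_average (Y z1 z2 : R -> R) (sg tau : R) :
  sg = 1 \/ sg = -1 -> tau = 1 \/ tau = -1 ->
  (forall t, continuity_pt Y t) ->
  (forall t, c - A < t < c + A -> ~ In t l ->
     is_derive Y t (w * v t * (sg * cos (2 * w * (t - c)) * z1 t
                               + tau * sin (2 * w * (t - c)) * z2 t))) ->
  (forall t, c - A <= t <= c + A ->
     Rabs (z1 t - z1 (c - A)) <= 8 * (G (t - c) - G (- A)) /\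
     Rabs (z2 t - z2 (c - A)) <= 8 * (G (t - c) - G (- A))) ->
  Rabs (Y (c + A) - Y (c - A) - sg * phi * z1 (c - A)) <= 8 * (G A - G (- A)) ^ 2.
Proof.
  intros Hsg Htau HYc HY Hz.
  assert (Hu1 : forall a, a = 1 \/ a = -1 -> forall x, Rabs x <= 1 -> Rabs (a * x) <= 1).
  { intros a [-> | ->] x Hx; [now rewrite Rmult_1_l |].
    replace (-1 * x) with (- x) by ring; now rewrite Rabs_Ropp. }
  assert (HGm : forall s, - A <= s -> 0 <= G s - G (- A)).
  { intros s Hs.
    assert (H : Rabs (0 - 0) <= G s - G (- A)).
    { apply (Rabs_increment_le (fun _ => 0) G (fun _ => 0) g); try easy.
      - intros t _; apply (is_derive_const 0 t).
      - intros t _; rewrite Rabs_R0.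
        apply Rle_trans with (2 := Hqg t), Rabs_pos. }
    revert H; replace (0 - 0) with 0 by ring; now rewrite Rabs_R0. }
  (* The increment of [P] is [phi] and that of [Q] vanishes by [HQA], so the term with [z2] may be
     inserted at no cost. *)
  replace (Y (c + A) - Y (c - A) - sg * phi * z1 (c - A)) with
    (Y (c + A) - Y (c - A)
     - z1 (c - A) * (sg * P (c + A - c) - sg * P (c - A - c))
     - z2 (c - A) * (tau * Q (c + A - c) - tau * Q (c - A - c))).
  2: { replace (c + A - c) with A by ring; replace (c - A - c) with (- A) by ring.
       rewrite Hphi, HQA; ring. }
  replace (G A) with (G (c + A - c)) by (f_equal; ring).
  refine (driven_average (c - A) (c + A) l (fun t => q (t - c))
            (fun t => sg * cos (2 * w * (t - c))) (fun t => tau * sin (2 * w * (t - c)))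
            (fun t => G (t - c) - G (- A)) (fun t => g (t - c)) Y z1 z2 8
            _ HYc _ _ _ _ _ (fun t => sg * P (t - c)) (fun t => tau * Q (t - c))
            _ _ _ _ _).
  - lra.
  - intros t; rewrite <- (Rminus_0_r (g (t - c))).
    apply (is_derive_Rminus (fun t => G (t - c)) (fun _ => G (- A))).
    + apply is_derive_shift, HG.
    + apply (is_derive_const (G (- A)) t).
  - intros t _; apply Hqg.
  - intros t; apply Hu1; [easy | apply Rabs_cos_le_1].
  - intros t; apply Hu1; [easy | apply Rabs_sin_le_1].
  - intros t Ht Hn; destruct (Hu t Ht) as [_ <-]; now apply HY.
  - replace (c - A - c) with (- A) by ring; ring.
  - intros t Ht; apply HGm; lra.
  - intros t; replace (q (t - c) * (sg * cos (2 * w * (t - c))))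
      with (sg * (q (t - c) * cos (2 * w * (t - c)))) by ring.
    apply (is_derive_Rscal sg (fun t => P (t - c))), is_derive_shift, HP.
  - intros t; replace (q (t - c) * (tau * sin (2 * w * (t - c))))
      with (tau * (q (t - c) * sin (2 * w * (t - c)))) by ring.
    apply (is_derive_Rscal tau (fun t => Q (t - c))), is_derive_shift, HQ.
  - exact Hz.
Qed.

(** A first, crude pass: the norm bound on the solution limits how far each component can move. This
    is the hypothesis on [z1] and [z2] that the averaging estimate needs. *)
Lemma frame_component_increment (Y z1 z2 : R -> R) (sg tau : R) :
  sg = 1 \/ sg = -1 -> tau = 1 \/ tau = -1 ->
  (forall t, continuity_pt Y t) ->
  (forall t, c - A < t < c + A -> ~ In t l ->
     is_derive Y t (w * v t * (sg * cos (2 * w * (t - c)) * z1 t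
                               + tau * sin (2 * w * (t - c)) * z2 t))) ->
  (forall t, c - A < t < c + A -> Rabs (z1 t) <= 4 /\ Rabs (z2 t) <= 4) ->
  forall t, c - A <= t <= c + A -> Rabs (Y t - Y (c - A)) <= 8 * (G (t - c) - G (- A)).
Proof.
  intros Hsg Htau HYc HY Hz t Ht.
  assert (Hu1 : forall a, a = 1 \/ a = -1 -> forall x, Rabs x <= 1 -> Rabs (a * x) <= 1).
  { intros a [-> | ->] x Hx; [now rewrite Rmult_1_l |].
    replace (-1 * x) with (- x) by ring; now rewrite Rabs_Ropp. }
  replace 8 with (2 * 4) by ring.
  replace (G (- A)) with (G (c - A - c)) by (f_equal; ring).
  refine (driven_increment_le (c - A) (c + A) l (fun t => q (t - c))
            (fun t => sg * cos (2 * w * (t - c))) (fun t => tau * sin (2 * w * (t - c)))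
            (fun t => G (t - c)) (fun t => g (t - c)) Y z1 z2 4
            HYc _ _ _ _ _ Hz t Ht).
  - intros s; apply is_derive_shift, HG.
  - intros s _; apply Hqg.
  - intros s; apply Hu1; [easy | apply Rabs_cos_le_1].
  - intros s; apply Hu1; [easy | apply Rabs_sin_le_1].
  - intros s Hs Hn; destruct (Hu s Hs) as [_ <-]; now apply HY.
Qed.

(** Each component serves as unknown in one equation and as coefficient in two others. The crude
    increments are therefore found for all four before any of them is averaged. *)
Lemma frame_average :
  let E := 8 * (G A - G (- A)) ^ 2 in
  Rabs (a1 (c + A) - a1 (c - A) - phi * b1 (c - A)) <= E /\
     Rabs (a2 (c + A) - a2 (c - A) - phi * b2 (c - A)) <= E /\
     Rabs (b1 (c + A) - b1 (c - A) + phi * a1 (c - A)) <= E /\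
     Rabs (b2 (c + A) - b2 (c - A) + phi * a2 (c - A)) <= E.
Proof.
  assert (Hmk : - kap = 1 \/ - kap = -1) by (destruct Hkap as [-> | ->]; lra).
  assert (H1 : 1 = 1 \/ 1 = -1) by lra.
  assert (H1' : -1 = 1 \/ -1 = -1) by lra.
  assert (Hb : forall t, c - A < t < c + A ->
    Rabs (a1 t) <= 4 /\ Rabs (a2 t) <= 4 /\ Rabs (b1 t) <= 4 /\ Rabs (b2 t) <= 4).
  { intros t Ht; destruct (flow_bound t) as (B1 & B2 & B3 & B4); [lra |].
    repeat split; now apply rot_bound. }
  assert (Ca1 : forall t, continuity_pt a1 t) by now apply continuity_pt_rot.
  assert (Ca2 : forall t, continuity_pt a2 t) by now apply continuity_pt_rot.
  assert (Cb1 : forall t, continuity_pt b1 t) by now apply continuity_pt_rot.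
  assert (Cb2 : forall t, continuity_pt b2 t) by now apply continuity_pt_rot.
  assert (D : forall t, c - A < t < c + A -> ~ In t l ->
    let C := cos (2 * w * (t - c)) in let S := sin (2 * w * (t - c)) in
    is_derive a1 t (w * v t * (1 * C * b1 t + - kap * S * b2 t)) /\
     is_derive a2 t (w * v t * (1 * C * b2 t + kap * S * b1 t)) /\
     is_derive b1 t (w * v t * (-1 * C * a1 t + - kap * S * a2 t)) /\
     is_derive b2 t (w * v t * (-1 * C * a2 t + kap * S * a1 t))).
  { intros t Ht Hn C S; destruct (Hu t Ht) as [Hut _].
    destruct (is_derive_frame t) as (D1 & D2 & D3 & D4); [lra | easy | easy |].
    fold C S in D1, D2, D3, D4.
    split; [| split; [| split]]; eapply is_derive_val; try eassumption; ring. }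
  assert (Ia1 := frame_component_increment a1 b1 b2 1 (- kap) H1 Hmk Ca1
                   (fun t Ht Hn => proj1 (D t Ht Hn))).
  assert (Ia2 := frame_component_increment a2 b2 b1 1 kap H1 Hkap Ca2
                   (fun t Ht Hn => proj1 (proj2 (D t Ht Hn)))).
  assert (Ib1 := frame_component_increment b1 a1 a2 (-1) (- kap) H1' Hmk Cb1
                   (fun t Ht Hn => proj1 (proj2 (proj2 (D t Ht Hn))))).
  assert (Ib2 := frame_component_increment b2 a2 a1 (-1) kap H1' Hkap Cb2
                   (fun t Ht Hn => proj2 (proj2 (proj2 (D t Ht Hn))))).
  specialize (Ia1 ltac:(intros t Ht; split; apply Hb, Ht)).
  specialize (Ia2 ltac:(intros t Ht; split; apply Hb, Ht)).
  specialize (Ib1 ltac:(intros t Ht; split; apply Hb, Ht)).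
  specialize (Ib2 ltac:(intros t Ht; split; apply Hb, Ht)).
  intros E.
  replace (phi * b1 (c - A)) with (1 * phi * b1 (c - A)) by ring.
  replace (phi * b2 (c - A)) with (1 * phi * b2 (c - A)) by ring.
  replace (b1 (c + A) - b1 (c - A) + phi * a1 (c - A))
    with (b1 (c + A) - b1 (c - A) - -1 * phi * a1 (c - A)) by ring.
  replace (b2 (c + A) - b2 (c - A) + phi * a2 (c - A))
    with (b2 (c + A) - b2 (c - A) - -1 * phi * a2 (c - A)) by ring.
  split; [| split; [| split]].
  - apply (frame_component_average a1 b1 b2 1 (- kap)); auto; intros; apply D; auto.
  - apply (frame_component_average a2 b2 b1 1 kap); auto; intros; apply D; auto.
  - apply (frame_component_average b1 a1 a2 (-1) (- kap)); auto; intros; apply D; auto.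
  - apply (frame_component_average b2 a2 a1 (-1) kap); auto; intros; apply D; auto.
Qed.

End Piece.

(** Without drive the frame coordinates stand still. This carries the state through the first and
    the last piece, where the frame is centred at [0] and at [T] and is the identity there. *)
Lemma frame_free (kap c x y : R) :
  kap = 1 \/ kap = -1 -> 0 <= x <= y -> y <= T ->
  (forall t, x < t < y -> u t = kap /\ v t = 0) ->
  rot (kap * w) c al1 al2 y = rot (kap * w) c al1 al2 x /\
  rot (- (kap * w)) c al2 al1 y = rot (- (kap * w)) c al2 al1 x /\
  rot (- (kap * w)) c be1 be2 y = rot (- (kap * w)) c be1 be2 x /\
  rot (kap * w) c be2 be1 y = rot (kap * w) c be2 be1 x.
Proof.
  intros Hkap Hx Hy Hu.
  assert (H0 : forall F, (forall t, continuity_pt F t) ->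
    (forall t, x < t < y -> ~ In t l -> is_derive F t 0) -> F y = F x).
  { intros F HF Hd.
    assert (H : Rabs (F y - F x) <= 0 - 0).
    { apply (Rabs_increment_le_off_finite F (fun _ => 0) l); try easy; try lra.
      - intros t; now apply continuity_pt_const.
      - intros t Ht Hn; exists 0, 0; split; [now apply Hd |].
        split; [apply (is_derive_const 0 t) | rewrite Rabs_R0; lra]. }
    destruct (Req_dec (F y - F x) 0) as [He | Hne]; [lra |].
    apply Rabs_pos_lt in Hne; lra. }
  split; [| split; [| split]]; apply H0; try now apply continuity_pt_rot.
  all: intros t Ht Hn; destruct (Hu t Ht) as [Hut Hvt];
    destruct (is_derive_frame kap c Hkap t) as (D1 & D2 & D3 & D4);
    [lra | easy | easy |]; rewrite Hvt in D1, D2, D3, D4.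
  - eapply is_derive_val; [exact D1 | ring].
  - eapply is_derive_val; [exact D2 | ring].
  - eapply is_derive_val; [exact D3 | ring].
  - eapply is_derive_val; [exact D4 | ring].
Qed.

End Flow.

Lemma rot_center (k c : R) (f g : R -> R) : rot k c f g c = f c.
Proof.
  unfold rot; replace (k * (c - c)) with 0 by ring; rewrite cos_0, sin_0; ring.
Qed.

Lemma rot_left (s w c A : R) (f g : R -> R) : s = 1 \/ s = -1 ->
  rot (s * w) c f g (c - A) = cos (w * A) * f (c - A) + s * sin (w * A) * g (c - A).
Proof.
  unfold rot; intros [-> | ->].
  - replace (1 * w * (c - A - c)) with (- (w * A)) by ring.
    rewrite cos_neg, sin_neg; ring.
  - replace (-1 * w * (c - A - c)) with (w * A) by ring; ring.
Qed.

(** The coefficients at the right end for [s] are those of [rot_left] at the left end for [- s].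
    Since [u] alternates, the frames of consecutive pieces agree at their common endpoint. *)
Lemma rot_right (s w c A : R) (f g : R -> R) : s = 1 \/ s = -1 ->
  rot (s * w) c f g (c + A) = cos (w * A) * f (c + A) - s * sin (w * A) * g (c + A).
Proof.
  unfold rot; intros [-> | ->].
  - replace (1 * w * (c + A - c)) with (w * A) by ring; ring.
  - replace (-1 * w * (c + A - c)) with (- (w * A)) by ring.
    rewrite cos_neg, sin_neg; ring.
Qed.

Lemma pow_m1_cases (k : nat) : (-1) ^ k = 1 \/ (-1) ^ k = -1.
Proof. induction k as [| k [IH | IH]]; simpl; [now left | |]; rewrite IH; lra. Qed.

Lemma flow_total (w A : R) (N : nat) (al1 al2 be1 be2 u v : R -> R) (l : list R)
  (q P Q G g : R -> R) :
  let T := (4 * INR N + 2) * A in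
  let phi := P A - P (- A) in
  let D := G A - G (- A) in
  0 < A ->
  (forall t, continuity_pt al1 t) -> (forall t, continuity_pt al2 t) ->
  (forall t, continuity_pt be1 t) -> (forall t, continuity_pt be2 t) ->
  (forall t, 0 < t < T -> ~ In t l ->
    is_derive al1 t (w * u t * al2 t + w * v t * be1 t) /\
    is_derive al2 t (- (w * u t * al1 t) + w * v t * be2 t) /\
    is_derive be1 t (- (w * u t * be2 t) - w * v t * al1 t) /\
    is_derive be2 t (w * u t * be1 t - w * v t * al2 t)) ->
  al1 0 ^ 2 + al2 0 ^ 2 + be1 0 ^ 2 + be2 0 ^ 2 = 2 ->
  (forall t, 0 < t < A -> u t = -1 /\ v t = 0) ->
  (forall t, T - A < t < T -> u t = 1 /\ v t = 0) ->
  (forall k t, (k < 2 * N)%nat ->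
     (2 * INR k + 1) * A < t < (2 * INR k + 3) * A ->
     u t = (-1) ^ k /\ w * v t = q (t - (2 * INR k + 2) * A)) ->
  (forall s, is_derive P s (q s * cos (2 * w * s))) ->
  (forall s, is_derive Q s (q s * sin (2 * w * s))) ->
  (forall s, is_derive G s (g s)) ->
  (forall s, Rabs (q s) <= g s) ->
  Q (- A) = Q A ->
  Rabs phi <= D ->
  let Phi := INR (2 * N) * phi in
  Rabs (al1 T - (cos Phi * al1 0 + sin Phi * be1 0)) <= 224 * INR N * D ^ 2 /\
  Rabs (be1 T - (cos Phi * be1 0 - sin Phi * al1 0)) <= 224 * INR N * D ^ 2 /\
  Rabs (al2 T - (cos Phi * al2 0 + sin Phi * be2 0)) <= 224 * INR N * D ^ 2 /\
  Rabs (be2 T - (cos Phi * be2 0 - sin Phi * al2 0)) <= 224 * INR N * D ^ 2.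
Proof.
  intros T phi D HA Ca1 Ca2 Cb1 Cb2 Hflow Hinit Hu0 HuT Hu HP HQ HG Hqg HQA HphiD Phi.
  assert (HN : 0 <= INR N) by apply pos_INR.
  assert (HT : A <= T) by (unfold T; nra).
  (* [tt k] is the left end of piece [k] and [kp k] the value of [u] on it; [x1], [x2], [y1], [y2]
     are the frame coordinates there, and by the matching of frames also those at the right end of
     the piece before. *)
  set (tt := fun k => (2 * INR k + 1) * A).
  set (kp := fun k => (-1) ^ k).
  assert (Hkp : forall k, kp k = 1 \/ kp k = -1) by apply pow_m1_cases.
  assert (Hkm : forall k, - kp k = 1 \/ - kp k = -1) by (intros k; destruct (Hkp k); lra).
  set (x1 := fun k => cos (w * A) * al1 (tt k) + kp k * sin (w * A) * al2 (tt k)).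
  set (x2 := fun k => cos (w * A) * al2 (tt k) + - kp k * sin (w * A) * al1 (tt k)).
  set (y1 := fun k => cos (w * A) * be1 (tt k) + - kp k * sin (w * A) * be2 (tt k)).
  set (y2 := fun k => cos (w * A) * be2 (tt k) + kp k * sin (w * A) * be1 (tt k)).
  assert (Hlast : forall k, (k < 2 * N)%nat -> INR k + 1 <= 2 * INR N).
  { intros k Hk; rewrite <- S_INR; replace (2 * INR N) with (INR (2 * N)).
    - now apply le_INR.
    - now rewrite mult_INR. }
  assert (Hstep : forall k, (k < 2 * N)%nat ->
    Rabs (x1 (S k) - x1 k - phi * y1 k) <= 8 * D ^ 2 /\
    Rabs (x2 (S k) - x2 k - phi * y2 k) <= 8 * D ^ 2 /\
    Rabs (y1 (S k) - y1 k + phi * x1 k) <= 8 * D ^ 2 /\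
    Rabs (y2 (S k) - y2 k + phi * x2 k) <= 8 * D ^ 2).
  { intros k Hk; set (c := (2 * INR k + 2) * A).
    assert (H := frame_average w T al1 al2 be1 be2 u v l Ca1 Ca2 Cb1 Cb2 Hflow Hinit
                   (kp k) c A (Hkp k) HA q P Q G g phi).
    assert (Hk0 := pos_INR k).
    assert (HAT : 0 <= c - A /\ c + A <= T).
    { unfold c, T; specialize (Hlast k Hk); nra. }
    specialize (H HAT).
    assert (Huk : forall t, c - A < t < c + A -> u t = kp k /\ w * v t = q (t - c)).
    { intros t Ht; apply Hu; [easy |]; unfold c in Ht; lra. }
    specialize (H Huk HP HQ HG Hqg eq_refl HQA); cbv zeta in H.
    replace (- (kp k * w)) with (- kp k * w) in H by ring.
    rewrite !rot_left, !rot_right in H by easy.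
    assert (Hcl : c - A = tt k) by (unfold c, tt; ring).
    assert (Hcr : c + A = tt (S k)) by (unfold c, tt; rewrite S_INR; ring).
    rewrite Hcl, Hcr in H; fold D in H.
    assert (Hks : kp (S k) = - kp k) by (unfold kp; simpl; ring).
    unfold x1, x2, y1, y2; rewrite Hks.
    destruct H as (H1 & H2 & H3 & H4).
    split; [| split; [| split]];
      [eapply Rle_trans; [| exact H1] | eapply Rle_trans; [| exact H2]
       | eapply Rle_trans; [| exact H3] | eapply Rle_trans; [| exact H4]];
      right; f_equal; ring. }
  assert (Hb : forall k, (k <= 2 * N)%nat -> Rabs (x1 k) <= 4 /\ Rabs (x2 k) <= 4 /\
    Rabs (y1 k) <= 4 /\ Rabs (y2 k) <= 4).
  { intros k Hk.
    assert (Hk' : INR k <= 2 * INR N).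
    { replace (2 * INR N) with (INR (2 * N)) by (now rewrite mult_INR).
      now apply le_INR. }
    assert (Hk0 := pos_INR k).
    assert (Htk : 0 <= tt k <= T) by (unfold tt, T; split; nra).
    destruct (flow_bound w T al1 al2 be1 be2 u v l Ca1 Ca2 Cb1 Cb2 Hflow Hinit _ Htk)
      as (B1 & B2 & B3 & B4).
    assert (Hs : forall a, a = 1 \/ a = -1 -> Rabs (a * sin (w * A)) <= 1).
    { intros a [-> | ->]; [rewrite Rmult_1_l | replace (-1 * sin (w * A)) with (- sin (w * A)) by ring;
        rewrite Rabs_Ropp]; apply Rabs_sin_le_1. }
    replace 4 with (2 * 2) by ring.
    repeat split; apply Rabs_comb2_le; auto using Rabs_cos_le_1. }
  (* The two undriven pieces have half the length of the others, so the frame angle is zero at [0]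
     and at [T]: the discrete sequences begin and end at the solution itself. *)
  destruct (frame_free w T al1 al2 be1 be2 u v l Ca1 Ca2 Cb1 Cb2 Hflow (-1) 0 0 A)
    as (F1 & F2 & F3 & F4); [lra | lra | easy | easy |].
  destruct (frame_free w T al1 al2 be1 be2 u v l Ca1 Ca2 Cb1 Cb2 Hflow 1 T (T - A) T)
    as (L1 & L2 & L3 & L4); [lra | lra | lra | easy |].
  rewrite Ropp_mult_distr_l in F2, F3, L2, L3.
  rewrite rot_center in F1, F2, F3, F4, L1, L2, L3, L4.
  assert (Hm : (- -1 = 1 \/ - -1 = -1)) by lra.
  assert (Hm' : (- (1) = 1 \/ - (1) = -1)) by lra.
  assert (E0 : forall s f g, s = 1 \/ s = -1 ->
    rot (s * w) 0 f g A = cos (w * A) * f A - s * sin (w * A) * g A).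
  { intros s f h Hs; assert (H := rot_right s w 0 A f h Hs).
    now rewrite Rplus_0_l in H. }
  rewrite E0 in F1, F2, F3, F4 by lra; rewrite rot_left in L1, L2, L3, L4 by lra.
  assert (Htt0 : tt 0%nat = A) by (unfold tt; simpl; ring).
  assert (HttN : tt (2 * N)%nat = T - A)
    by (unfold tt, T; rewrite mult_INR; simpl; ring).
  assert (HkN : kp (2 * N)%nat = 1) by apply pow_1_even.
  assert (Hx10 : x1 0%nat = al1 0)
    by (unfold x1; rewrite Htt0; unfold kp; simpl; rewrite <- F1; ring).
  assert (Hx20 : x2 0%nat = al2 0)
    by (unfold x2; rewrite Htt0; unfold kp; simpl; rewrite <- F2; ring).
  assert (Hy10 : y1 0%nat = be1 0)
    by (unfold y1; rewrite Htt0; unfold kp; simpl; rewrite <- F3; ring).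
  assert (Hy20 : y2 0%nat = be2 0)
    by (unfold y2; rewrite Htt0; unfold kp; simpl; rewrite <- F4; ring).
  assert (Hx1N : x1 (2 * N)%nat = al1 T) by (unfold x1; rewrite HttN, HkN, L1; ring).
  assert (Hx2N : x2 (2 * N)%nat = al2 T) by (unfold x2; rewrite HttN, HkN, L2; ring).
  assert (Hy1N : y1 (2 * N)%nat = be1 T) by (unfold y1; rewrite HttN, HkN, L3; ring).
  assert (Hy2N : y2 (2 * N)%nat = be2 T) by (unfold y2; rewrite HttN, HkN, L4; ring).
  destruct (euler_steps_vs_rotation phi (8 * D ^ 2) 4 x1 y1 (2 * N)) as [R1 R2].
  { intros k Hk; split; apply Hb, Hk. }
  { intros k Hk; split; apply Hstep, Hk. }
  destruct (euler_steps_vs_rotation phi (8 * D ^ 2) 4 x2 y2 (2 * N)) as [R3 R4].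
  { intros k Hk; split; apply Hb, Hk. }
  { intros k Hk; split; apply Hstep, Hk. }
  rewrite Hx10, Hy10, Hx1N in R1; rewrite Hx10, Hy10, Hy1N in R2.
  rewrite Hx20, Hy20, Hx2N in R3; rewrite Hx20, Hy20, Hy2N in R4.
  fold Phi in R1, R2, R3, R4.
  (* With [phi^2 <= D^2], the [2N] steps give [8 N (12 + 16) D^2 = 224 N D^2]. *)
  assert (HB : 4 * INR (2 * N) * (3 * 4 * phi ^ 2 + 2 * (8 * D ^ 2)) <= 224 * INR N * D ^ 2).
  { rewrite mult_INR; replace (INR 2) with 2 by (simpl; ring).
    assert (phi ^ 2 <= D ^ 2); [| nra].
    assert (0 <= Rabs phi) by apply Rabs_pos.
    rewrite <- (pow2_abs phi); nra. }
  repeat split; eapply Rle_trans; try exact HB; assumption.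
Qed.

(** * Decay of oscillatory integrals *)

Lemma ex_RInt_continuity (f : R -> R) (a b : R) :
  (forall x, continuity_pt f x) -> ex_RInt f a b.
Proof.
  intros H; apply (ex_RInt_continuous (V := R_CompleteNormedModule)).
  intros x _; apply continuity_pt_filterlim, H.
Qed.

Lemma is_derive_RInt_continuity (f : R -> R) (a x : R) :
  (forall x, continuity_pt f x) -> is_derive (fun x => RInt f a x) x (f x).
Proof.
  intros H; apply (is_derive_RInt f (fun x => RInt f a x) a).
  - apply filter_forall; intros y; apply (RInt_correct (V := R_CompleteNormedModule)).
    now apply ex_RInt_continuity.
  - apply continuity_pt_filterlim, H.
Qed.

Lemma RInt_ftc (F f : R -> R) (a b : R) :
  (forall x, is_derive F x (f x)) -> (forall x, continuity_pt f x) ->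
  RInt f a b = F b - F a.
Proof.
  intros HF Hf; apply (is_RInt_unique (V := R_CompleteNormedModule)).
  apply (is_RInt_derive (V := R_CompleteNormedModule) F f); [easy |].
  intros x _; apply continuity_pt_filterlim, Hf.
Qed.

Lemma RInt_lin (f g : R -> R) (p q a b : R) :
  (forall x, continuity_pt f x) -> (forall x, continuity_pt g x) ->
  RInt (fun x => p * f x + q * g x) a b = p * RInt f a b + q * RInt g a b.
Proof.
  intros Hf Hg.
  assert (If := ex_RInt_continuity f a b Hf); assert (Ig := ex_RInt_continuity g a b Hg).
  apply (is_RInt_unique (V := R_CompleteNormedModule)).
  apply (is_RInt_plus (V := R_NormedModule) (fun x => p * f x) (fun x => q * g x));
    apply (is_RInt_scal (V := R_NormedModule));
    now apply (RInt_correct (V := R_CompleteNormedModule)).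
Qed.

Lemma RInt_zero_on (f : R -> R) (a b : R) :
  (forall x, Rmin a b < x < Rmax a b -> f x = 0) -> RInt f a b = 0.
Proof.
  intros H; rewrite (RInt_ext (V := R_CompleteNormedModule) f (fun _ => 0)) by easy.
  rewrite RInt_const; unfold scal; simpl; unfold mult; simpl; ring.
Qed.

Lemma ex_derive_continuity_pt (f : R -> R) (x : R) : ex_derive f x -> continuity_pt f x.
Proof. intros [d H]; now apply (is_derive_continuity_pt f x d). Qed.

Lemma continuity_pt_bounded (f : R -> R) (a b : R) :
  a <= b -> (forall x, continuity_pt f x) ->
  exists M, 0 <= M /\ forall x, a <= x <= b -> Rabs (f x) <= M.
Proof.
  intros Hab Hf.
  destruct (continuity_ab_maj (fun x => Rabs (f x)) a b Hab) as [m [Hm _]].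
  - intros c _; apply (continuity_pt_comp f Rabs); [easy | apply Rcontinuity_abs].
  - exists (Rabs (f m)); split; [apply Rabs_pos | easy].
Qed.

(** Class [C^k] with support in [[a, b]]. The derivatives are carried as witnesses, so closure under
    operations needs no formula for the [k]-th derivative. *)
Fixpoint smooth_in (a b : R) (k : nat) (phi : R -> R) : Prop :=
  (forall x, x < a \/ b < x -> phi x = 0) /\
  (forall x, continuity_pt phi x) /\
  match k with
  | O => True
  | S k => exists psi, (forall x, is_derive phi x (psi x)) /\ smooth_in a b k psi
  end.

Section SmoothIn.

Variables (a b : R).

Lemma smooth_in_zero (k : nat) (phi : R -> R) :
  smooth_in a b k phi -> forall x, x < a \/ b < x -> phi x = 0.
Proof. destruct k; now intros [H _]. Qed.

Lemma smooth_in_continuity (k : nat) (phi : R -> R) :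
  smooth_in a b k phi -> forall x, continuity_pt phi x.
Proof. destruct k; now intros (_ & H & _). Qed.

Lemma smooth_in_pred (k : nat) : forall phi, smooth_in a b (S k) phi -> smooth_in a b k phi.
Proof.
  induction k as [| k IH]; intros phi (H1 & H2 & psi & H3 & H4).
  - repeat split; easy.
  - split; [easy |]; split; [easy |]; exists psi; auto.
Qed.

Lemma smooth_in_minus (k : nat) : forall phi chi,
  smooth_in a b k phi -> smooth_in a b k chi -> smooth_in a b k (fun x => phi x - chi x).
Proof.
  induction k as [| k IH]; intros phi chi (H1 & H2 & H3) (G1 & G2 & G3);
    (split; [intros x Hx; rewrite H1, G1 by easy; ring |]);
    (split; [intros x; now apply continuity_pt_minus |]); [easy |].
  destruct H3 as (p & Hp & Hp'); destruct G3 as (r & Hr & Hr').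
  exists (fun x => p x - r x); split; [| now apply IH].
  intros x; now apply is_derive_Rminus.
Qed.

Lemma locally_outside (x : R) : x < a \/ b < x -> locally x (fun y => y < a \/ b < y).
Proof.
  intros [H | H].
  - apply (filter_imp (fun y => y < a)); [tauto | now apply open_lt].
  - apply (filter_imp (fun y => b < y)); [tauto | now apply open_gt].
Qed.

Lemma is_derive_outside (phi : R -> R) (x : R) :
  (forall x, x < a \/ b < x -> phi x = 0) -> x < a \/ b < x -> is_derive phi x 0.
Proof.
  intros H Hx; apply (is_derive_ext_loc (fun _ => 0)).
  - apply (filter_imp (fun y => y < a \/ b < y)); [| now apply locally_outside].
    intros y Hy; symmetry; now apply H.
  - apply (is_derive_const 0 x).
Qed.

Lemma smooth_in_of_smooth (k : nat) : forall phi,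
  smooth phi -> (forall x, x < a \/ b < x -> phi x = 0) -> smooth_in a b k phi.
Proof.
  assert (Hc : forall phi, smooth phi -> forall x, continuity_pt phi x).
  { intros phi H x; apply ex_derive_continuity_pt, (H 1%nat x). }
  induction k as [| k IH]; intros phi Hs H0;
    (split; [easy |]); (split; [now apply Hc |]); [easy |].
  exists (Derive phi); split.
  - intros x; apply Derive_correct, (Hs 1%nat x).
  - apply IH.
    + intros [| j] x; [easy |].
      apply (ex_derive_ext (Derive_n phi (S j))); [| apply (Hs (S (S j)) x)].
      intros t; rewrite <- (Nat.add_1_r j); symmetry; apply (Derive_n_comp phi j 1).
    + intros x Hx; apply is_derive_unique; now apply is_derive_outside.
Qed.

Hypothesis Ha : 0 < a.

Lemma is_derive_div_id (phi : R -> R) (x d : R) :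
  (forall x, x < a \/ b < x -> phi x = 0) -> is_derive phi x d ->
  is_derive (fun x => phi x / x) x (d / x - phi x / x / x).
Proof.
  intros H0 Hd; destruct (Rlt_or_le 0 x) as [Hx | Hx].
  - assert (ex_derive phi x) by (now exists d).
    auto_derive; [split; [easy | lra] |].
    replace (Derive (fun x => phi x) x) with d by (symmetry; now apply is_derive_unique).
    field; lra.
  - assert (Hx' : x < a \/ b < x) by lra.
    replace d with 0.
    + rewrite H0 by easy; unfold Rdiv; rewrite !Rmult_0_l, Rminus_0_r.
      apply is_derive_outside; [| easy].
      intros y Hy; rewrite H0 by easy; ring.
    + rewrite <- (is_derive_unique _ _ _ Hd); symmetry.
      apply is_derive_unique; now apply is_derive_outside.
Qed.

Lemma continuity_pt_div_id (phi : R -> R) (x : R) :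
  (forall x, x < a \/ b < x -> phi x = 0) -> continuity_pt phi x ->
  continuity_pt (fun x => phi x / x) x.
Proof.
  intros H0 Hc; destruct (Rlt_or_le 0 x) as [Hx | Hx].
  - apply continuity_pt_mult; [easy |].
    apply continuity_pt_inv; [apply derivable_continuous_pt, derivable_pt_id | lra].
  - apply (is_derive_continuity_pt _ x 0), is_derive_outside; [| lra].
    intros y Hy; rewrite H0 by easy; unfold Rdiv; ring.
Qed.

(** Since [0 < a], the quotient vanishes near every [x <= 0], and the default value of the inverse
    at [0] is multiplied by [0]. The derivative is written with iterated quotients by [x] so that
    the induction hypothesis, applied once or twice, covers both of its terms. *)
Lemma smooth_in_div_id (k : nat) : forall phi,
  smooth_in a b k phi -> smooth_in a b k (fun x => phi x / x).
Proof.
  induction k as [| k IH]; intros phi Hphi; pose proof Hphi as (H1 & H2 & H3);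
    (split; [intros x Hx; rewrite H1 by easy; unfold Rdiv; ring |]);
    (split; [intros x; now apply continuity_pt_div_id |]); [easy |].
  destruct H3 as (psi & Hd & Hpsi).
  exists (fun x => psi x / x - phi x / x / x); split.
  - intros x; now apply is_derive_div_id.
  - apply smooth_in_minus; [now apply IH |].
    apply (IH (fun x => phi x / x)), IH; now apply smooth_in_pred.
Qed.

End SmoothIn.

Lemma continuity_cos_lin (k x : R) : continuity_pt (fun x => cos (k * x)) x.
Proof. apply ex_derive_continuity_pt; auto_derive; easy. Qed.

Lemma continuity_sin_lin (k x : R) : continuity_pt (fun x => sin (k * x)) x.
Proof. apply ex_derive_continuity_pt; auto_derive; easy. Qed.

(** Each integration by parts gains [1 / (2 s)], weakened to [1 / s]. The boundary terms vanish
    because [a'] and [b'] lie strictly outside the support; sine and cosine are treated together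
    because each step exchanges them. *)
Lemma oscillatory_integral_decay (a b a' b' : R) (k : nat) :
  a' < a -> b < b' -> a' <= b' -> forall phi, smooth_in a b k phi ->
  exists C, 0 <= C /\ forall s, 0 < s ->
    Rabs (RInt (fun x => phi x * cos (2 * s * x)) a' b') <= C / s ^ k /\
    Rabs (RInt (fun x => phi x * sin (2 * s * x)) a' b') <= C / s ^ k.
Proof.
  intros Ha Hb Hab.
  induction k as [| k IH]; intros phi Hphi.
  - destruct (continuity_pt_bounded phi a' b' Hab (smooth_in_continuity _ _ _ _ Hphi))
      as (M & HM & Hb').
    exists ((b' - a') * M); split; [nra |]; intros s Hs.
    replace ((b' - a') * M / s ^ 0) with ((b' - a') * M) by (simpl; field).
    assert (Hc := smooth_in_continuity _ _ _ _ Hphi).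
    split; (apply abs_RInt_le_const; [easy | |]).
    + apply ex_RInt_continuity; intros x.
      apply continuity_pt_mult; [easy | apply continuity_cos_lin].
    + intros t Ht; rewrite Rabs_mult.
      assert (H := Hb' t Ht); assert (H' := Rabs_cos_le_1 (2 * s * t)).
      assert (0 <= Rabs (cos (2 * s * t))) by apply Rabs_pos.
      assert (0 <= Rabs (phi t)) by apply Rabs_pos; nra.
    + apply ex_RInt_continuity; intros x.
      apply continuity_pt_mult; [easy | apply continuity_sin_lin].
    + intros t Ht; rewrite Rabs_mult.
      assert (H := Hb' t Ht); assert (H' := Rabs_sin_le_1 (2 * s * t)).
      assert (0 <= Rabs (sin (2 * s * t))) by apply Rabs_pos.
      assert (0 <= Rabs (phi t)) by apply Rabs_pos; nra.
  - assert (Hc := smooth_in_continuity _ _ _ _ Hphi).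
    destruct Hphi as (H0 & _ & psi & Hd & Hpsi).
    destruct (IH psi Hpsi) as (C & HC & Hdec).
    assert (Hcp := smooth_in_continuity _ _ _ _ Hpsi).
    exists C; split; [easy |]; intros s Hs.
    destruct (Hdec s Hs) as [D1 D2].
    assert (Za : phi a' = 0) by (apply H0; lra).
    assert (Zb : phi b' = 0) by (apply H0; lra).
    assert (Ccos := continuity_cos_lin (2 * s)); assert (Csin := continuity_sin_lin (2 * s)).
    (* Integration by parts, read as the fundamental theorem for [phi(x) sin(2 s x)], which is zero
       at both ends. *)
    assert (Ec : 1 * RInt (fun x => psi x * sin (2 * s * x)) a' b'
                 + 2 * s * RInt (fun x => phi x * cos (2 * s * x)) a' b' = 0).
    { rewrite <- RInt_lin by (intros x; now apply continuity_pt_mult).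
      rewrite (RInt_ftc (fun x => phi x * sin (2 * s * x))).
      - rewrite Za, Zb; ring.
      - intros x; assert (ex_derive phi x) by (now exists (psi x)).
        auto_derive; [easy |].
        replace (Derive (fun x => phi x) x) with (psi x)
          by (symmetry; now apply is_derive_unique).
        ring.
      - intros x; apply (continuity_pt_plus (fun _ => _) (fun _ => _));
          apply continuity_pt_mult; try (now apply continuity_pt_const);
          now apply continuity_pt_mult. }
    assert (Es : 1 * RInt (fun x => psi x * cos (2 * s * x)) a' b'
                 + - (2 * s) * RInt (fun x => phi x * sin (2 * s * x)) a' b' = 0).
    { rewrite <- RInt_lin by (intros x; now apply continuity_pt_mult).
      rewrite (RInt_ftc (fun x => phi x * cos (2 * s * x))).
      - rewrite Za, Zb; ring.
      - intros x; assert (ex_derive phi x) by (now exists (psi x)).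
        auto_derive; [easy |].
        replace (Derive (fun x => phi x) x) with (psi x)
          by (symmetry; now apply is_derive_unique).
        ring.
      - intros x; apply (continuity_pt_plus (fun _ => _) (fun _ => _));
          apply continuity_pt_mult; try (now apply continuity_pt_const);
          now apply continuity_pt_mult. }
    assert (Hsk : 0 < s ^ k) by now apply pow_lt.
    assert (Hred : forall I J p : R, Rabs p = 2 * s -> 1 * J + p * I = 0 ->
      Rabs J <= C / s ^ k -> Rabs I <= C / s ^ S k).
    { intros I J p Hp HIJ HJ.
      assert (He : J = - (p * I)) by lra.
      rewrite He, Rabs_Ropp, Rabs_mult, Hp in HJ.
      replace (C / s ^ S k) with (C / s ^ k / s) by (simpl; field; lra).
      apply Rle_div_r; [easy |].
      assert (0 <= Rabs I) by apply Rabs_pos; nra. }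
    assert (H2s : Rabs (2 * s) = 2 * s) by (apply Rabs_pos_eq; lra).
    split.
    + now apply (Hred _ _ (2 * s) H2s Ec).
    + rewrite <- Rabs_Ropp in H2s; now apply (Hred _ _ (- (2 * s)) H2s Es).
Qed.

(** * Fourier inversion by Abel summation *)

Lemma is_derive_RInt_weight (h : R -> R) (k dk : R -> R -> R) (a b x : R) :
  (forall w, continuity_pt h w) ->
  (forall s w, continuity_pt (fun w => k s w) w) ->
  (forall s w, is_derive (fun s => k s w) s (dk s w)) ->
  (forall s w, continuity_2d_pt dk s w) ->
  is_derive (fun s => RInt (fun w => h w * k s w) a b) x
    (RInt (fun w => h w * dk x w) a b).
Proof.
  intros Hh Hk Hdk Hc.
  assert (Hd : forall s w, is_derive (fun s => h w * k s w) s (h w * dk s w)).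
  { intros s w; now apply (is_derive_Rscal (h w) (fun s => k s w)). }
  assert (He : RInt (fun w => h w * dk x w) a b
               = RInt (fun w => Derive (fun s => h w * k s w) x) a b).
  { apply (RInt_ext (V := R_CompleteNormedModule)); intros w _.
    symmetry; apply is_derive_unique, Hd. }
  rewrite He; apply (is_derive_RInt_param (fun s w => h w * k s w)).
  - apply filter_forall; intros s w _; eexists; apply Hd.
  - intros w _.
    apply (continuity_2d_pt_ext (fun s w => h w * dk s w)).
    + intros s y; symmetry; apply is_derive_unique, Hd.
    + apply continuity_2d_pt_mult; [| apply Hc].
      apply (continuity_1d_2d_pt_comp h (fun _ w => w)); [apply Hh | apply continuity_2d_pt_id2].
  - apply filter_forall; intros s; apply ex_RInt_continuity; intros w.
    now apply continuity_pt_mult.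
Qed.

Lemma continuity_2d_cos_mul (c s w : R) :
  continuity_2d_pt (fun s w => cos (c * (s * w))) s w.
Proof.
  apply (continuity_1d_2d_pt_comp cos (fun s w => c * (s * w))).
  - apply ex_derive_continuity_pt; now auto_derive.
  - apply continuity_2d_pt_mult; [apply continuity_2d_pt_const |].
    apply continuity_2d_pt_mult; [apply continuity_2d_pt_id1 | apply continuity_2d_pt_id2].
Qed.

Lemma continuity_2d_sin_mul (c s w : R) :
  continuity_2d_pt (fun s w => sin (c * (s * w))) s w.
Proof.
  apply (continuity_1d_2d_pt_comp sin (fun s w => c * (s * w))).
  - apply ex_derive_continuity_pt; now auto_derive.
  - apply continuity_2d_pt_mult; [apply continuity_2d_pt_const |].
    apply continuity_2d_pt_mult; [apply continuity_2d_pt_id1 | apply continuity_2d_pt_id2].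
Qed.

(** The mean value theorem is applied twice, with [M] a bound of the second derivative. A quadratic
    remainder is wanted because the Poisson kernel multiplied by the squared distance to its peak is
    [O(d)] uniformly. *)
Lemma taylor_1_bound (h h1 h2 : R -> R) (a b : R) :
  a <= b -> (forall x, is_derive h x (h1 x)) -> (forall x, is_derive h1 x (h2 x)) ->
  (forall x, continuity_pt h2 x) ->
  exists M, 0 <= M /\ forall x y, a <= x <= b -> a <= y <= b ->
    Rabs (h y - h x - h1 x * (y - x)) <= M * (y - x) ^ 2.
Proof.
  intros Hab H1 H2 H3.
  destruct (continuity_pt_bounded h2 a b Hab H3) as (M & HM & Hb).
  exists M; split; [easy |]; intros x y Hx Hy.
  replace (h y - h x - h1 x * (y - x)) with ((h y - h1 x * y) - (h x - h1 x * x)) by ring.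
  replace (M * (y - x) ^ 2) with (M * Rabs (y - x) * Rabs (y - x)).
  2: { rewrite <- (pow2_abs (y - x)); ring. }
  assert (Hin : forall t z, a <= z <= b -> Rmin z x <= t <= Rmax z x -> a <= t <= b).
  { intros t z Hz [Ht1 Ht2]; split.
    - apply Rle_trans with (2 := Ht1), Rmin_glb; lra.
    - apply Rle_trans with (1 := Ht2), Rmax_lub; lra. }
  apply (lipschitz_of_derive (fun t => h t - h1 x * t) (fun t => h1 t - h1 x)).
  - intros t; apply (is_derive_Rminus h (fun t => h1 x * t)); [easy |].
    apply is_derive_val with (h1 x * 1); [| ring].
    apply (is_derive_Rscal (h1 x) (fun t => t)), (is_derive_id t).
  - intros t Ht; apply Rle_trans with (M * Rabs (t - x)).
    + apply (lipschitz_of_derive h1 h2); [easy |].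
      intros r Hr; apply Hb, (Hin r t); [| easy]; now apply (Hin t y).
    + apply Rmult_le_compat_l; [easy |].
      unfold Rmin, Rmax in Ht; destruct (Rle_dec y x).
      * rewrite !Rabs_left1; lra.
      * rewrite !Rabs_pos_eq; lra.
Qed.

Lemma exp_neg_le (x : R) : 0 < x -> exp (- x) <= / x.
Proof.
  intros Hx; rewrite exp_Ropp; apply Rinv_le_contravar; [easy |].
  assert (H := exp_ineq1_le x); lra.
Qed.

Lemma exp_neg_le_1 (x : R) : 0 <= x -> exp (- x) <= 1.
Proof.
  intros Hx; rewrite exp_Ropp, <- Rinv_1; apply Rinv_le_contravar; [lra |].
  assert (H := exp_ineq1_le x); lra.
Qed.

Lemma atan_error (z : R) : 0 < z -> Rabs (atan z - PI / 2) <= / z.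
Proof.
  intros Hz.
  assert (Hi : 0 < / z) by now apply Rinv_0_lt_compat.
  replace (atan z - PI / 2) with (- atan (/ z)) by (rewrite atan_inv by easy; ring).
  rewrite Rabs_Ropp.
  replace (atan (/ z)) with (atan (/ z) - atan 0) by (rewrite atan_0; ring).
  replace (/ z) with (1 * Rabs (/ z - 0)) at 2.
  - apply (lipschitz_of_derive atan (fun t => / (1 + t²))).
    + intros t; apply is_derive_atan.
    + intros t _; assert (0 <= t²) by apply Rle_0_sqr.
      assert (0 < / (1 + t²)) by (apply Rinv_0_lt_compat; lra).
      rewrite Rabs_pos_eq by lra.
      rewrite <- Rinv_1; apply Rinv_le_contravar; lra.
  - rewrite Rminus_0_r, Rabs_pos_eq by lra; ring.
Qed.

(* [abel d B y] is the integral of [e^(-d s) cos (s y)] over [[0, B]]; for [d > 0]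
   it has no singularity at [y = 0], and tends to the Poisson kernel as [B] grows. *)
Definition abel (d B y : R) : R :=
  (d + exp (- (d * B)) * (y * sin (B * y) - d * cos (B * y))) / (d ^ 2 + y ^ 2).

Definition poisson (d y : R) : R := d / (d ^ 2 + y ^ 2).

Lemma sq_sum_pos (d y : R) : 0 < d -> 0 < d ^ 2 + y ^ 2.
Proof. intros Hd; nra. Qed.

Lemma abel_0 (d y : R) : abel d 0 y = 0.
Proof.
  unfold abel; rewrite Rmult_0_r, Ropp_0, exp_0, Rmult_0_l, sin_0, cos_0.
  unfold Rdiv; ring.
Qed.

Lemma is_derive_abel (d B y : R) : 0 < d ->
  is_derive (fun B => abel d B y) B (exp (- (d * B)) * cos (B * y)).
Proof.
  intros Hd; assert (Hp := sq_sum_pos d y Hd).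
  unfold abel; auto_derive; [lra |]; field; lra.
Qed.

(** The difference has the denominator [d^2 + y^2], as small as [d^2] at the peak. The threshold
    [1 / d^3] makes [e^(- d B) <= 1 / (d B) <= d^2], which absorbs it. *)
Lemma abel_poisson (d B y : R) : 0 < d <= 1 -> / d ^ 3 <= B ->
  Rabs (abel d B y - poisson d y) <= 2 * d.
Proof.
  intros Hd HB; assert (Hp := sq_sum_pos d y (proj1 Hd)).
  assert (Hd3 : 0 < d ^ 3) by (apply pow_lt; lra).
  assert (HB0 : 0 < B) by (apply Rlt_le_trans with (2 := HB); now apply Rinv_0_lt_compat).
  replace (abel d B y - poisson d y)
    with (exp (- (d * B)) * (y * sin (B * y) + - d * cos (B * y)) / (d ^ 2 + y ^ 2))
    by (unfold abel, poisson; field; lra).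
  assert (He : exp (- (d * B)) <= d ^ 2).
  { apply Rle_trans with (/ (d * B)); [apply exp_neg_le; nra |].
    rewrite <- (Rinv_inv (d ^ 2)); apply Rinv_le_contravar.
    - apply Rinv_0_lt_compat; nra.
    - replace (/ d ^ 2) with (d * / d ^ 3) by (field; lra).
      apply Rmult_le_compat_l; lra. }
  assert (He0 := exp_pos (- (d * B))).
  unfold Rdiv; rewrite Rabs_mult, (Rabs_pos_eq (/ _))
    by (apply Rlt_le; now apply Rinv_0_lt_compat).
  apply Rle_div_l; [easy |].
  rewrite Rabs_mult, (Rabs_pos_eq (exp _)) by lra.
  assert (Hn : Rabs (y * sin (B * y) + - d * cos (B * y)) <= Rabs y + d).
  { apply Rle_trans with (1 := Rabs_triang _ _); rewrite !Rabs_mult, Rabs_Ropp.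
    rewrite (Rabs_pos_eq d) by lra.
    assert (H1 := Rabs_sin_le_1 (B * y)); assert (H2 := Rabs_cos_le_1 (B * y)).
    assert (H3 := Rabs_pos y); nra. }
  assert (Hy := Rabs_pos y); assert (Hy2 := pow2_abs y).
  apply Rle_trans with (d ^ 2 * (Rabs y + d)).
  - apply Rmult_le_compat; try lra; apply Rabs_pos.
  - rewrite <- Hy2; assert (0 <= (Rabs y - d) ^ 2) by apply pow2_ge_0; nra.
Qed.

Lemma Rabs_poisson_mul_le (d y x : R) : 0 < d -> 0 < x -> x <= y ->
  Rabs (poisson d y) <= d / x ^ 2.
Proof.
  intros Hd Hx Hy; unfold poisson.
  assert (Hp := sq_sum_pos d y Hd).
  rewrite Rabs_pos_eq by (apply Rlt_le, Rdiv_lt_0_compat; easy).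
  apply Rmult_le_compat_l; [lra |]; apply Rinv_le_contravar; nra.
Qed.

Lemma poisson_sq_le (d y : R) : 0 < d -> Rabs (poisson d y * y ^ 2) <= d.
Proof.
  intros Hd; unfold poisson; assert (Hp := sq_sum_pos d y Hd).
  rewrite Rabs_pos_eq.
  - apply Rmult_le_reg_r with (1 := Hp).
    replace (d / (d ^ 2 + y ^ 2) * y ^ 2 * (d ^ 2 + y ^ 2)) with (d * y ^ 2)
      by (field; lra).
    nra.
  - apply Rmult_le_pos; [| apply pow2_ge_0].
    apply Rlt_le, Rdiv_lt_0_compat; easy.
Qed.

Section Inversion.

Variables (v0 v1 b : R) (h h1 h2 : R -> R).
Hypothesis Hv0 : 0 < v0.
Hypothesis Hv : v0 < v1.
Hypothesis Hb : v1 < b.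
Hypothesis Hh : forall x, continuity_pt h x.
Hypothesis Hh1 : forall x, is_derive h x (h1 x).
Hypothesis Hh2 : forall x, is_derive h1 x (h2 x).
Hypothesis Ch2 : forall x, continuity_pt h2 x.

(** With [h(x) = f(x) / x] this is, up to a constant factor, the Fourier transform of [profile f];
    the [2] comes from the dilation in [omega g(2 omega) = f(omega)]. *)
Definition cos_transform (s : R) : R := RInt (fun x => h x * cos (2 * s * x)) 0 b.

Lemma continuity_cos_transform (s : R) : continuity_pt cos_transform s.
Proof.
  apply (is_derive_continuity_pt _ s (RInt (fun x => h x * (- (2 * x) * sin (2 * (s * x)))) 0 b)).
  apply (is_derive_ext (fun s => RInt (fun x => h x * cos (2 * (s * x))) 0 b)).
  { intros t; apply (RInt_ext (V := R_CompleteNormedModule)); intros x _.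
    now rewrite Rmult_assoc. }
  apply (is_derive_RInt_weight h (fun s x => cos (2 * (s * x)))
           (fun s x => - (2 * x) * sin (2 * (s * x)))); [easy | | |].
  - intros r x; apply ex_derive_continuity_pt; now auto_derive.
  - intros r x; auto_derive; [easy | ring].
  - intros r x; apply continuity_2d_pt_mult; [| apply continuity_2d_sin_mul].
    apply continuity_2d_pt_opp, continuity_2d_pt_mult;
      [apply continuity_2d_pt_const | apply continuity_2d_pt_id2].
Qed.

Variable omega : R.
Hypothesis Homega : v0 <= omega <= v1.

(** The integral of [e^(- d s) cos(2 s x) cos(2 omega s)] over [[0, B]], the product of cosines
    being split into a sum. *)
Definition abel_kernel (d B x : R) : R :=
  / 2 * (abel d B (2 * (x - omega)) + abel d B (2 * (x + omega))).

Definition abel_transform (d B : R) : R := RInt (fun x => h x * abel_kernel d B x) 0 b.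

Lemma continuity_abel_kernel (d B x : R) : 0 < d ->
  continuity_pt (abel_kernel d B) x.
Proof.
  intros Hd; apply ex_derive_continuity_pt; unfold abel_kernel, abel.
  assert (H1 := sq_sum_pos d (2 * (x - omega)) Hd).
  assert (H2 := sq_sum_pos d (2 * (x + omega)) Hd).
  auto_derive; repeat split; unfold Rminus in *; simpl in *; lra.
Qed.

Lemma abel_transform_0 (d : R) : abel_transform d 0 = 0.
Proof.
  apply RInt_zero_on; intros x _; unfold abel_kernel; rewrite !abel_0; ring.
Qed.

(** Together with [abel_transform_0] this identifies [abel_transform d B] with the damped inversion
    integral over [[0, B]]. Differentiating in [B] under the integral sign takes the place of
    Fubini's theorem. *)
Lemma is_derive_abel_transform (d B : R) : 0 < d ->
  is_derive (abel_transform d) B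
    (exp (- (d * B)) * (cos_transform B * cos (2 * omega * B))).
Proof.
  intros Hd.
  replace (exp (- (d * B)) * (cos_transform B * cos (2 * omega * B)))
    with (RInt (fun x => h x * (exp (- (d * B)) * cos (2 * omega * B) * cos (2 * (B * x)))) 0 b).
  - apply (is_derive_RInt_weight h (abel_kernel d)
             (fun B x => exp (- (d * B)) * cos (2 * omega * B) * cos (2 * (B * x)))); [easy | | |].
    + intros s x; now apply continuity_abel_kernel.
    + intros s x; unfold abel_kernel.
      apply is_derive_val with
        (/ 2 * (exp (- (d * s)) * cos (s * (2 * (x - omega)))
                + exp (- (d * s)) * cos (s * (2 * (x + omega))))).
      * apply (is_derive_Rscal (/ 2)
                 (fun s => abel d s (2 * (x - omega)) + abel d s (2 * (x + omega)))).
        apply (is_derive_plus (fun s => abel d s (2 * (x - omega)))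
                 (fun s => abel d s (2 * (x + omega)))); now apply is_derive_abel.
      * replace (s * (2 * (x - omega))) with (2 * (s * x) - 2 * omega * s) by ring.
        replace (s * (2 * (x + omega))) with (2 * (s * x) + 2 * omega * s) by ring.
        rewrite cos_minus, cos_plus; field.
    + intros s x; apply continuity_2d_pt_mult; [| apply continuity_2d_cos_mul].
      apply (continuity_1d_2d_pt_comp (fun B => exp (- (d * B)) * cos (2 * omega * B))
               (fun s _ => s)); [| apply continuity_2d_pt_id1].
      apply ex_derive_continuity_pt; now auto_derive.
  - set (e := exp (- (d * B)) * cos (2 * omega * B)).
    replace (exp (- (d * B)) * (cos_transform B * cos (2 * omega * B)))
      with (e * cos_transform B + 0 * cos_transform B) by (unfold e; ring).
    unfold cos_transform; rewrite <- RInt_lin.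
    + apply (RInt_ext (V := R_CompleteNormedModule)); intros x _.
      rewrite <- Rmult_assoc; ring_simplify; now rewrite !Rmult_assoc.
    + intros x; apply continuity_pt_mult; [easy | apply continuity_cos_lin].
    + intros x; apply continuity_pt_mult; [easy | apply continuity_cos_lin].
Qed.

(* The first two terms are exact primitives: an arctangent, whose increment
   tends to [PI / 4], and a logarithm weighted by [d]. *)
Lemma poisson_moments : exists C, 0 <= C /\ forall d, 0 < d <= 1 ->
  Rabs (RInt (fun x => h omega * (/ 2 * poisson d (2 * (x - omega)))
                       + h1 omega * ((x - omega) * (/ 2 * poisson d (2 * (x - omega))))) 0 b
        - PI / 4 * h omega) <= C * d.
Proof.
  (* A bound free of [d]: for [0 < d <= 1] the logarithm lies between [ln (4 x^2)] and
     [ln (1 + 4 x^2)]. *)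
  set (lnb := fun x => Rabs (ln ((2 * x) ^ 2)) + Rabs (ln (1 + (2 * x) ^ 2))).
  assert (Hln : forall d x, 0 < d <= 1 -> x <> 0 -> Rabs (ln (d ^ 2 + (2 * x) ^ 2)) <= lnb x).
  { intros d x Hd Hx; unfold lnb.
    assert (Hx2 : 0 < (2 * x) ^ 2) by (apply pow2_gt_0; lra).
    assert (L1 : ln ((2 * x) ^ 2) <= ln (d ^ 2 + (2 * x) ^ 2))
      by (apply ln_le; [easy | nra]).
    assert (L2 : ln (d ^ 2 + (2 * x) ^ 2) <= ln (1 + (2 * x) ^ 2))
      by (apply ln_le; nra).
    assert (R1 := Rle_abs (ln (1 + (2 * x) ^ 2))).
    assert (R2 := Rle_abs (- ln ((2 * x) ^ 2))); rewrite Rabs_Ropp in R2.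
    assert (R3 := Rabs_pos (ln (1 + (2 * x) ^ 2))).
    assert (R4 := Rabs_pos (ln ((2 * x) ^ 2))).
    apply Rabs_le; lra. }
  exists (Rabs (h omega) * (/ (b - omega) + / omega)
          + Rabs (h1 omega) * (lnb (b - omega) + lnb omega)).
  assert (P1 : 0 < / (b - omega)) by (apply Rinv_0_lt_compat; lra).
  assert (P2 : 0 < / omega) by (apply Rinv_0_lt_compat; lra).
  assert (P3 : forall x, 0 <= lnb x) by (intros x; apply Rplus_le_le_0_compat; apply Rabs_pos).
  assert (P4 := Rabs_pos (h omega)); assert (P5 := Rabs_pos (h1 omega)).
  split.
  { apply Rplus_le_le_0_compat; apply Rmult_le_pos; try lra.
    now apply Rplus_le_le_0_compat. }
  intros d Hd.
  assert (Hden : forall x, 0 < d ^ 2 + (2 * (x - omega)) ^ 2) by (intros x; apply sq_sum_pos; lra).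
  rewrite (RInt_ftc (fun x => h omega * (/ 4 * atan (2 * (x - omega) / d))
                      + h1 omega * (d / 16 * ln (d ^ 2 + (2 * (x - omega)) ^ 2)))).
  2: { intros x; specialize (Hden x); unfold poisson; auto_derive.
       - repeat split; unfold Rminus in *; simpl in *; lra.
       - field; repeat split; unfold Rminus in *; simpl in *; nra. }
  2: { intros x; specialize (Hden x); apply ex_derive_continuity_pt; unfold poisson.
       auto_derive; repeat split; unfold Rminus in *; simpl in *; lra. }
  assert (A1 := atan_error (2 * (b - omega) / d) ltac:(apply Rdiv_lt_0_compat; lra)).
  assert (A2 := atan_error (2 * omega / d) ltac:(apply Rdiv_lt_0_compat; lra)).
  replace (2 * (0 - omega) / d) with (- (2 * omega / d)) by (field; lra).
  rewrite atan_opp.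
  replace ((2 * (0 - omega)) ^ 2) with ((2 * omega) ^ 2) by ring.
  assert (L1 := Hln d (b - omega) Hd ltac:(lra)).
  assert (L2 := Hln d omega Hd ltac:(lra)).
  set (t1 := atan (2 * (b - omega) / d)) in *; set (t2 := atan (2 * omega / d)) in *.
  set (l1 := ln (d ^ 2 + (2 * (b - omega)) ^ 2)) in *.
  set (l2 := ln (d ^ 2 + (2 * omega) ^ 2)) in *.
  match goal with |- Rabs ?e <= _ =>
    replace e with (h omega * (/ 4 * ((t1 - PI / 2) + (t2 - PI / 2)))
                    + h1 omega * (d / 16 * (l1 + - l2))) by field end.
  apply Rle_trans with (1 := Rabs_triang _ _).
  rewrite Rmult_plus_distr_r; apply Rplus_le_compat.
  - rewrite Rabs_mult, Rmult_assoc; apply Rmult_le_compat_l; [easy |].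
    rewrite Rabs_mult, (Rabs_pos_eq (/ 4)) by lra.
    assert (T := Rabs_triang (t1 - PI / 2) (t2 - PI / 2)).
    replace (/ (2 * (b - omega) / d)) with (/ 2 * (/ (b - omega) * d)) in A1 by (field; lra).
    replace (/ (2 * omega / d)) with (/ 2 * (/ omega * d)) in A2 by (field; lra).
    assert (0 < / (b - omega) * d) by (apply Rmult_lt_0_compat; lra).
    assert (0 < / omega * d) by (apply Rmult_lt_0_compat; lra).
    lra.
  - rewrite Rabs_mult, Rmult_assoc; apply Rmult_le_compat_l; [easy |].
    rewrite Rabs_mult, (Rabs_pos_eq (d / 16)) by lra.
    assert (T := Rabs_triang l1 (- l2)); rewrite Rabs_Ropp in T.
    assert (H1 := P3 (b - omega)); assert (H2 := P3 omega); nra.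
Qed.

(** The kernel concentrates at [x = omega], where [h] is replaced by its first-order Taylor
    polynomial, whose integral is [poisson_moments]. The constant depends on [omega], which is
    harmless because [d -> 0] is taken for fixed [omega]. *)
Lemma abel_transform_limit : exists C, 0 <= C /\ forall d B, 0 < d <= 1 -> / d ^ 3 <= B ->
  Rabs (abel_transform d B - PI / 4 * h omega) <= C * d.
Proof.
  destruct poisson_moments as (C1 & HC1 & Hmom).
  destruct (taylor_1_bound h h1 h2 0 b ltac:(lra) Hh1 Hh2 Ch2) as (M & HM & Htay).
  destruct (continuity_pt_bounded h 0 b ltac:(lra) Hh) as (Mh & HMh & Hbh).
  assert (Hi : 0 < / omega ^ 2) by (apply Rinv_0_lt_compat, pow_lt; lra).
  (* [2] pays for replacing both truncated kernels by Poisson kernels, [/ omega ^ 2] for the mirror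
     peak at [- omega] outside the range of integration, and [M] for the Taylor remainder. *)
  set (C2 := Mh * (2 + / omega ^ 2) + M).
  assert (HC2 : 0 <= C2) by (unfold C2; nra).
  exists (C1 + b * C2); split; [nra |].
  intros d B Hd HB.
  set (main := fun x => h omega * (/ 2 * poisson d (2 * (x - omega)))
                 + h1 omega * ((x - omega) * (/ 2 * poisson d (2 * (x - omega))))).
  assert (Cmain : forall x, continuity_pt main x).
  { intros x; assert (Hden := sq_sum_pos d (2 * (x - omega)) (proj1 Hd)).
    apply ex_derive_continuity_pt; unfold main, poisson.
    auto_derive; repeat split; unfold Rminus in *; simpl in *; lra. }
  assert (Ck : forall x, continuity_pt (fun x => h x * abel_kernel d B x) x).
  { intros x; apply continuity_pt_mult; [easy | apply continuity_abel_kernel; lra]. }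
  assert (Hdiff : Rabs (abel_transform d B - RInt main 0 b) <= (b - 0) * (C2 * d)).
  { replace (abel_transform d B - RInt main 0 b)
      with (1 * abel_transform d B + -1 * RInt main 0 b) by ring.
    unfold abel_transform; rewrite <- RInt_lin by easy.
    apply abs_RInt_le_const; [lra | |].
    - apply ex_RInt_continuity; intros x.
      apply (continuity_pt_plus (fun _ => _) (fun _ => _));
        apply continuity_pt_mult; try easy; now apply continuity_pt_const.
    - intros x Hx.
      assert (E1 := abel_poisson d B (2 * (x - omega)) Hd HB).
      assert (E2 := abel_poisson d B (2 * (x + omega)) Hd HB).
      assert (E3 := Rabs_poisson_mul_le d (2 * (x + omega)) omega
                      ltac:(lra) ltac:(lra) ltac:(lra)).
      assert (E4 := poisson_sq_le d (2 * (x - omega)) (proj1 Hd)).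
      assert (E5 := Htay omega x ltac:(lra) Hx).
      assert (E6 := Hbh x Hx).
      unfold abel_kernel, main.
      set (k1 := abel d B (2 * (x - omega))) in *.
      set (k2 := abel d B (2 * (x + omega))) in *.
      set (p1 := poisson d (2 * (x - omega))) in *.
      set (p2 := poisson d (2 * (x + omega))) in *.
      set (rem := h x - h omega - h1 omega * (x - omega)) in *.
      match goal with |- Rabs ?e <= _ =>
        replace e with (h x * (/ 2 * ((k1 - p1) + ((k2 - p2) + p2))) + / 2 * (p1 * rem))
          by (unfold rem; field) end.
      apply Rle_trans with (1 := Rabs_triang _ _).
      assert (T1 : Rabs (h x * (/ 2 * ((k1 - p1) + ((k2 - p2) + p2))))
                   <= Mh * (2 + / omega ^ 2) * d).
      { rewrite Rabs_mult, Rmult_assoc; apply Rmult_le_compat; try apply Rabs_pos; [easy |].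
        rewrite Rabs_mult, (Rabs_pos_eq (/ 2)) by lra.
        assert (T := Rabs_triang (k1 - p1) ((k2 - p2) + p2)).
        assert (T' := Rabs_triang (k2 - p2) p2).
        unfold Rdiv in E3; assert (0 < d * / omega ^ 2) by (apply Rmult_lt_0_compat; lra).
        lra. }
      assert (T2 : Rabs (/ 2 * (p1 * rem)) <= M * d).
      { rewrite !Rabs_mult, (Rabs_pos_eq (/ 2)) by lra.
        assert (Hp1 := Rabs_pos p1).
        assert (Rabs p1 * Rabs rem <= Rabs p1 * (M * (x - omega) ^ 2))
          by (now apply Rmult_le_compat_l).
        rewrite Rabs_mult, (Rabs_pos_eq ((2 * (x - omega)) ^ 2)) in E4 by apply pow2_ge_0.
        replace ((2 * (x - omega)) ^ 2) with (4 * (x - omega) ^ 2) in E4 by ring.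
        assert (0 <= Rabs p1 * (x - omega) ^ 2)
          by (apply Rmult_le_pos; [easy | apply pow2_ge_0]).
        assert (M * (4 * (Rabs p1 * (x - omega) ^ 2)) <= M * d)
          by (apply Rmult_le_compat_l; lra).
        nra. }
      unfold C2; lra. }
  assert (Hm := Hmom d Hd); fold main in Hm.
  replace (abel_transform d B - PI / 4 * h omega)
    with ((abel_transform d B - RInt main 0 b) + (RInt main 0 b - PI / 4 * h omega)) by ring.
  apply Rle_trans with (1 := Rabs_triang _ _); lra.
Qed.

(** Three comparisons: removing the damping on [[0, A]] costs [O(d)]; the damped tail from [A] to
    [B] is bounded uniformly in [d]; the damped integral up to [B] is [O(d)] away from its limit.
    Letting [d -> 0] leaves the tail. *)
Lemma cos_inversion_error (C0 C : R) (n : nat) (A : R) :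
  0 < A -> (1 <= n)%nat -> 0 <= C0 -> 0 <= C ->
  (forall s, Rabs (cos_transform s) <= C0) ->
  (forall s, 0 < s -> Rabs (cos_transform s) <= C / s ^ S n) ->
  Rabs (RInt (fun s => cos_transform s * cos (2 * omega * s)) 0 A - PI / 4 * h omega)
    <= C / A ^ n.
Proof.
  intros HA Hn HC0 HC Hbd Hdec.
  destruct abel_transform_limit as (K & HK & Hlim).
  set (J := fun A => RInt (fun s => cos_transform s * cos (2 * omega * s)) 0 A).
  assert (HcJ : forall s, continuity_pt (fun s => cos_transform s * cos (2 * omega * s)) s).
  { intros s; apply continuity_pt_mult; [apply continuity_cos_transform | apply continuity_cos_lin]. }
  assert (HdJ : forall s, is_derive J s (cos_transform s * cos (2 * omega * s)))
    by (intros s; now apply (is_derive_RInt_continuity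
                      (fun s => cos_transform s * cos (2 * omega * s)) 0 s)).
  assert (Hpt : forall s, Rabs (cos_transform s * cos (2 * omega * s)) <= Rabs (cos_transform s)).
  { intros s; rewrite Rabs_mult; assert (H := Rabs_cos_le_1 (2 * omega * s)).
    assert (H' := Rabs_pos (cos_transform s)); nra. }
  assert (Hall : forall d, 0 < d <= 1 ->
    Rabs (J A - PI / 4 * h omega) <= C / A ^ n + (C0 * A * A + K) * d).
  { intros d Hd.
    assert (Hi : 0 < / d ^ 3) by (apply Rinv_0_lt_compat, pow_lt; lra).
    (* Large enough both to exceed [A] and to pass the threshold [1 / d^3]. *)
    set (B := A + / d ^ 3).
    assert (E1 := Hlim d B Hd ltac:(unfold B; lra)).
    assert (E2 : Rabs ((J A - abel_transform d A) - (J 0 - abel_transform d 0))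
                 <= C0 * A * d * A - C0 * A * d * 0).
    { apply (Rabs_increment_le (fun s => J s - abel_transform d s) (fun s => C0 * A * d * s)
               (fun s => cos_transform s * cos (2 * omega * s)
                  - exp (- (d * s)) * (cos_transform s * cos (2 * omega * s)))
               (fun _ => C0 * A * d)); [lra | | |].
      - intros s _; apply is_derive_Rminus; [easy | apply is_derive_abel_transform; lra].
      - intros s _; auto_derive; [easy | ring].
      - intros s Hs.
        replace (cos_transform s * cos (2 * omega * s)
                  - exp (- (d * s)) * (cos_transform s * cos (2 * omega * s)))
          with ((cos_transform s * cos (2 * omega * s)) * (1 - exp (- (d * s)))) by ring.
        rewrite Rabs_mult; replace (C0 * A * d) with (C0 * (A * d)) by ring.
        apply Rmult_le_compat; try apply Rabs_pos.
        + apply Rle_trans with (1 := Hpt s), Hbd.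
        + assert (X := exp_ineq1_le (- (d * s))).
          assert (X' : exp (- (d * s)) <= 1) by (apply exp_neg_le_1; nra).
          rewrite Rabs_pos_eq by lra; nra. }
    assert (HJ0 : J 0 = 0) by apply (RInt_point (V := R_CompleteNormedModule)).
    rewrite HJ0, abel_transform_0 in E2.
    assert (HAn : 0 < A ^ n) by now apply pow_lt.
    assert (HBn : 0 < B ^ n) by (apply pow_lt; unfold B; lra).
    (* The comparison function [- C / s^n] has derivative [n C / s^(n+1)], which dominates the decay
       [C / s^(n+1)] because [n >= 1]. *)
    assert (E3 : Rabs (abel_transform d B - abel_transform d A) <= - C / B ^ n - - C / A ^ n).
    { apply (Rabs_increment_le (abel_transform d) (fun s => - C / s ^ n)
               (fun s => exp (- (d * s)) * (cos_transform s * cos (2 * omega * s)))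
               (fun s => INR n * C / s ^ S n)); [unfold B; lra | | |].
      - intros s _; apply is_derive_abel_transform; lra.
      - intros s Hs.
        assert (Hsn : 0 < s ^ n) by (apply pow_lt; lra).
        auto_derive; [lra |].
        destruct n as [| m]; [lia |].
        assert (Hsm : 0 < s ^ m) by (apply pow_lt; lra).
        simpl pred; simpl pow; field; split; lra.
      - intros s Hs; rewrite Rabs_mult, (Rabs_pos_eq (exp _)) by (apply Rlt_le, exp_pos).
        assert (X' : exp (- (d * s)) <= 1) by (apply exp_neg_le_1; nra).
        assert (Hd' := Hdec s ltac:(lra)); assert (Hp' := Hpt s).
        assert (P0 := Rabs_pos (cos_transform s * cos (2 * omega * s))).
        assert (1 <= INR n) by (apply (le_INR 1); lia).
        assert (0 <= C / s ^ S n) by (apply Rle_trans with (2 := Hd'), Rabs_pos).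
        replace (INR n * C / s ^ S n) with (INR n * (C / s ^ S n)) by (unfold Rdiv; ring).
        assert (Hexp := exp_pos (- (d * s))); nra. }
    replace (J A - PI / 4 * h omega) with
      ((J A - abel_transform d A - (0 - 0))
       + (- (abel_transform d B - abel_transform d A)
          + (abel_transform d B - PI / 4 * h omega))) by ring.
    apply Rle_trans with (1 := Rabs_triang _ _).
    assert (T := Rabs_triang (- (abel_transform d B - abel_transform d A))
                   (abel_transform d B - PI / 4 * h omega)).
    rewrite Rabs_Ropp in T.
    assert (0 <= C / B ^ n) by (apply Rmult_le_pos; [easy | apply Rlt_le; now apply Rinv_0_lt_compat]).
    unfold Rdiv in *; lra. }
  assert (HL : 0 <= C0 * A * A + K) by (assert (0 <= C0 * A * A) by nra; lra).
  set (L := C0 * A * A + K) in *; fold (J A).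
  (* The limit [d -> 0]: taking [d <= e / (L + 1)] makes the term [L d] at most [e]. *)
  apply Rle_plus_epsilon; intros e He.
  assert (Hm : 0 < Rmin 1 (e / (L + 1))) by (apply Rmin_glb_lt; [lra | apply Rdiv_lt_0_compat; lra]).
  assert (H := Hall (Rmin 1 (e / (L + 1))) (conj Hm (Rmin_l _ _))).
  assert (Hr := Rmin_r 1 (e / (L + 1))).
  assert (L * Rmin 1 (e / (L + 1)) <= e); [| lra].
  apply Rle_trans with (L * (e / (L + 1))); [now apply Rmult_le_compat_l |].
  replace e with ((L + 1) * (e / (L + 1))) at 2 by (field; lra).
  assert (0 < e / (L + 1)) by (apply Rdiv_lt_0_compat; lra); nra.
Qed.

End Inversion.

(** * The pulse as a cosine transform *)

Lemma is_RInt_compact (F : R -> R) (c a b : R) :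
  0 <= c -> (forall x, continuity_pt F x) -> (forall x, c < Rabs x -> F x = 0) ->
  a < - c -> c < b -> is_RInt F a b (RInt F (- c) c).
Proof.
  intros Hc HF H0 Ha Hb.
  assert (Hex : forall x y, ex_RInt F x y) by (intros; now apply ex_RInt_continuity).
  assert (H : RInt F a b = RInt F (- c) c).
  { rewrite <- (RInt_Chasles (V := R_CompleteNormedModule) F a (- c) b) by easy.
    rewrite <- (RInt_Chasles (V := R_CompleteNormedModule) F (- c) c b) by easy.
    rewrite (RInt_zero_on F a (- c)), (RInt_zero_on F c b).
    - unfold plus; simpl; ring.
    - rewrite Rmin_left, Rmax_right by lra; intros x Hx; apply H0.
      rewrite Rabs_pos_eq; lra.
    - rewrite Rmin_left, Rmax_right by lra; intros x Hx; apply H0.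
      rewrite Rabs_left; lra. }
  rewrite <- H; now apply (RInt_correct (V := R_CompleteNormedModule)).
Qed.

(** The integral no longer changes once its bounds leave the support, so the improper integral is
    attained. *)
Lemma fourier_compact (g : R -> R) (c t : R) :
  0 <= c -> (forall x, continuity_pt g x) -> (forall x, c < Rabs x -> g x = 0) ->
  Re (fourier g t) = / sqrt (2 * PI) * RInt (fun x => g x * cos (t * x)) (- c) c.
Proof.
  intros Hc Hg H0; unfold fourier.
  set (F1 := fun x => g x * cos (t * x)); set (F2 := fun x => - (g x * sin (t * x))).
  rewrite (is_RInt_gen_unique (V := C_R_CompleteNormedModule) _
             (RInt F1 (- c) c, RInt F2 (- c) c)).
  - simpl; ring.
  - intros P HP.
    apply (Filter_prod _ _ _ (fun x => x < - c) (fun x => c < x)).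
    + now exists (- c).
    + now exists c.
    + intros a b Ha Hb; exists (RInt F1 (- c) c, RInt F2 (- c) c).
      split; [| now apply locally_singleton in HP].
      simpl fst; simpl snd.
      apply (is_RInt_fct_extend_pair (U := R_NormedModule) (V := R_NormedModule)).
      * apply (is_RInt_ext (V := R_NormedModule) F1).
        { intros x _; simpl; unfold F1; rewrite cos_neg; ring. }
        apply is_RInt_compact; try easy.
        { intros x; apply continuity_pt_mult; [easy | apply continuity_cos_lin]. }
        { intros x Hx; unfold F1; rewrite H0 by easy; ring. }
      * apply (is_RInt_ext (V := R_NormedModule) F2).
        { intros x _; simpl; unfold F2; rewrite sin_neg; ring. }
        apply is_RInt_compact; try easy.
        { intros x; apply continuity_pt_opp.
          apply continuity_pt_mult; [easy | apply continuity_sin_lin]. }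
        { intros x Hx; unfold F2; rewrite H0 by easy; ring. }
Qed.

Lemma RInt_opp_bounds (F : R -> R) (A : R) :
  (forall x, continuity_pt F x) -> RInt F (- A) 0 = RInt (fun x => F (- x)) 0 A.
Proof.
  intros HF.
  assert (H := RInt_comp_lin (V := R_CompleteNormedModule) F (-1) 0 0 A).
  replace (-1 * 0 + 0) with 0 in H by ring; replace (-1 * A + 0) with (- A) in H by ring.
  specialize (H (ex_RInt_continuity F 0 (- A) HF)).
  rewrite <- (opp_RInt_swap (V := R_CompleteNormedModule)) by now apply ex_RInt_continuity.
  rewrite <- H.
  rewrite <- (RInt_opp (V := R_CompleteNormedModule)).
  - apply (RInt_ext (V := R_CompleteNormedModule)); intros x _.
    unfold opp, scal; simpl; unfold mult; simpl.
    replace (-1 * x + 0) with (- x) by ring; ring.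
  - apply (ex_RInt_ext (V := R_NormedModule) (fun x => -1 * F (- x))).
    { intros x _; unfold scal; simpl; unfold mult; simpl.
      now replace (-1 * x + 0) with (- x) by ring. }
    apply ex_RInt_continuity; intros x.
    apply continuity_pt_mult; [now apply continuity_pt_const |].
    apply (continuity_pt_comp Ropp F); [| apply HF].
    apply continuity_pt_opp, derivable_continuous_pt, derivable_pt_id.
Qed.

Lemma RInt_even (F : R -> R) (A : R) :
  (forall x, continuity_pt F x) -> (forall x, F (- x) = F x) ->
  RInt F (- A) A = 2 * RInt F 0 A.
Proof.
  intros HF He.
  rewrite <- (RInt_Chasles (V := R_CompleteNormedModule) F (- A) 0 A)
    by now apply ex_RInt_continuity.
  rewrite RInt_opp_bounds by easy.
  rewrite (RInt_ext (V := R_CompleteNormedModule) (fun x => F (- x)) F) by easy.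
  unfold plus; simpl; ring.
Qed.

Lemma RInt_odd (F : R -> R) (A : R) :
  (forall x, continuity_pt F x) -> (forall x, F (- x) = - F x) ->
  RInt F (- A) A = 0.
Proof.
  intros HF Ho.
  rewrite <- (RInt_Chasles (V := R_CompleteNormedModule) F (- A) 0 A)
    by now apply ex_RInt_continuity.
  rewrite RInt_opp_bounds by easy.
  rewrite (RInt_ext (V := R_CompleteNormedModule) (fun x => F (- x)) (fun x => opp (F x))) by easy.
  rewrite (RInt_opp (V := R_CompleteNormedModule)) by now apply ex_RInt_continuity.
  unfold plus, opp; simpl; ring.
Qed.

Section Profile.

Variables (v0 v1 : R) (f : R -> R).
Hypothesis Hv0 : 0 < v0.
Hypothesis Hv : v0 < v1.
Hypothesis Hf : Cc_infty f.
Hypothesis Hsupp : included (support f) (fun w => v0 <= w <= v1).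

Let h (x : R) : R := f x / x.
Let H : R -> R := cos_transform (v1 + 1) h.

Lemma smooth_in_quotient (k : nat) : smooth_in v0 v1 k h.
Proof.
  apply smooth_in_div_id; [easy |]; apply smooth_in_of_smooth; [apply Hf |].
  intros x Hx; destruct (Req_dec (f x) 0) as [-> | Hne]; [easy | exfalso].
  assert (Hin : support f x).
  { intros V [d Hd]; exists x; split; [| easy].
    apply Hd; unfold disc; rewrite Rminus_diag, Rabs_R0; apply cond_pos. }
  apply Hsupp in Hin; lra.
Qed.

Lemma quotient_0 (x : R) : x < v0 \/ v1 < x -> h x = 0.
Proof. apply (smooth_in_zero _ _ 0 h (smooth_in_quotient 0)). Qed.

Lemma continuity_quotient (x : R) : continuity_pt h x.
Proof. apply (smooth_in_continuity _ _ 0 h (smooth_in_quotient 0)). Qed.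

(** Evenness and the substitution [x = 2 w] give a factor [2] each; with the two factors
    [1 / sqrt (2 PI)] this is [4 / (2 N 2 PI) = 1 / (N PI)]. *)
Lemma pulse_cos_transform (N : nat) (s : R) : (1 <= N)%nat ->
  pulse f N s = H s / (INR N * PI).
Proof.
  intros HN; assert (HN' : 1 <= INR N) by now apply (le_INR 1).
  assert (Hpr : forall x, profile f x = h (Rabs x / 2)) by easy.
  assert (Hc : forall x, continuity_pt (profile f) x).
  { intros x; apply (continuity_pt_comp (fun x => Rabs x / 2) h); [| apply continuity_quotient].
    apply continuity_pt_mult; [apply Rcontinuity_abs | now apply continuity_pt_const]. }
  assert (Hcc : forall x, continuity_pt (fun x => profile f x * cos (s * x)) x).
  { intros x; apply continuity_pt_mult; [easy | apply continuity_cos_lin]. }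
  unfold pulse; rewrite (fourier_compact _ (2 * (v1 + 1))); [| lra | easy |].
  2: { intros x Hx; rewrite Hpr; apply quotient_0; right; lra. }
  rewrite RInt_even.
  2: easy.
  2: { intros x; rewrite profile_even; f_equal; rewrite <- cos_neg; f_equal; ring. }
  assert (HI : RInt (fun x => profile f x * cos (s * x)) 0 (2 * (v1 + 1)) = 2 * H s).
  { assert (HL := RInt_comp_lin (V := R_CompleteNormedModule)
                   (fun x => profile f x * cos (s * x)) 2 0 0 (v1 + 1)).
    replace (2 * 0 + 0) with 0 in HL by ring.
    replace (2 * (v1 + 1) + 0) with (2 * (v1 + 1)) in HL by ring.
    rewrite <- HL by now apply ex_RInt_continuity.
    replace (2 * H s) with (2 * H s + 0 * H s) by ring.
    unfold H, cos_transform; rewrite <- RInt_lin.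
    - apply (RInt_ext (V := R_CompleteNormedModule)).
      rewrite Rmin_left, Rmax_right by lra; intros x Hx.
      unfold scal; simpl; unfold mult; simpl.
      rewrite Hpr, Rplus_0_r, Rabs_pos_eq by lra.
      replace (2 * x / 2) with x by field; replace (s * (2 * x)) with (2 * s * x) by ring.
      ring.
    - intros x; apply continuity_pt_mult; [apply continuity_quotient | apply continuity_cos_lin].
    - intros x; apply continuity_pt_mult; [apply continuity_quotient | apply continuity_cos_lin]. }
  rewrite HI.
  assert (HPI := PI_RGT_0).
  assert (Hs : 0 < sqrt (2 * PI)) by (apply sqrt_lt_R0; lra).
  assert (Hss : sqrt (2 * PI) * sqrt (2 * PI) = 2 * PI) by (apply sqrt_sqrt; lra).
  replace (/ sqrt (2 * PI) * (2 * (2 * H s)) / (2 * INR N * sqrt (2 * PI)))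
    with (2 * H s / (INR N * (sqrt (2 * PI) * sqrt (2 * PI)))) by (field; lra).
  rewrite Hss; field; lra.
Qed.

Lemma cos_transform_even (s : R) : H (- s) = H s.
Proof.
  apply (RInt_ext (V := R_CompleteNormedModule)); intros x _; f_equal.
  rewrite <- cos_neg; f_equal; ring.
Qed.

(** One constant serves both estimates: two integrations by parts give a majorant with a bounded
    primitive, and [n + 1] of them give a tail of order [A^(- n)]. It is chosen before [A] and
    [omega], which makes the final constant uniform. *)
Lemma cos_transform_constants (n : nat) : (1 <= n)%nat ->
  exists C, 0 <= C /\ (forall s, Rabs (H s) <= C / (1 + s ^ 2)) /\
    forall A omega, 0 < A -> v0 <= omega <= v1 ->
      Rabs (RInt (fun s => H s * cos (2 * omega * s)) 0 A - PI / 4 * h omega) <= C / A ^ n.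
Proof.
  intros Hn.
  destruct (continuity_pt_bounded h 0 (v1 + 1) ltac:(lra) continuity_quotient) as (M & HM & HhM).
  set (C0 := (v1 + 1) * M).
  assert (HC0 : 0 <= C0) by (unfold C0; nra).
  assert (Hbd : forall s, Rabs (H s) <= C0).
  { intros s; unfold C0; rewrite <- (Rminus_0_r (v1 + 1)) at 1.
    apply abs_RInt_le_const; [lra | |].
    - apply ex_RInt_continuity; intros x.
      apply continuity_pt_mult; [apply continuity_quotient | apply continuity_cos_lin].
    - intros t Ht; rewrite Rabs_mult; assert (E := HhM t Ht).
      assert (E1 := Rabs_cos_le_1 (2 * s * t)); assert (E2 := Rabs_pos (cos (2 * s * t))).
      assert (E3 := Rabs_pos (h t)); nra. }
  destruct (oscillatory_integral_decay v0 v1 0 (v1 + 1) 2 ltac:(lra) ltac:(lra) ltac:(lra)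
              h (smooth_in_quotient 2)) as (C2 & HC2 & D2).
  destruct (oscillatory_integral_decay v0 v1 0 (v1 + 1) (S n) ltac:(lra) ltac:(lra) ltac:(lra)
              h (smooth_in_quotient (S n))) as (C3 & HC3 & D3).
  exists (C0 + C2 + C3); split; [lra |]; split.
  - assert (Hpos : forall s, 0 < s -> Rabs (H s) <= (C0 + C2 + C3) / (1 + s ^ 2)).
    { intros s Hs; destruct (D2 s Hs) as [D _]; fold (cos_transform (v1 + 1) h s) in D.
      fold (H s) in D; assert (D' := Hbd s).
      assert (Hs2 : 0 < s ^ 2) by now apply pow_lt.
      apply Rle_div_r in D; [| easy].
      apply Rle_div_r; [lra |]; assert (E := Rabs_pos (H s)); nra. }
    intros s; destruct (Rtotal_order s 0) as [Hs | [-> | Hs]].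
    + rewrite <- cos_transform_even.
      replace (s ^ 2) with ((- s) ^ 2) by ring; apply Hpos; lra.
    + assert (D' := Hbd 0); replace (1 + 0 ^ 2) with 1 by ring.
      unfold Rdiv; rewrite Rinv_1; lra.
    + now apply Hpos.
  - intros A omega HA Hom.
    destruct (smooth_in_quotient 2) as (_ & _ & h1 & Hd1 & _ & _ & h2 & Hd2 & _ & Ch2 & _).
    apply Rle_trans with (C3 / A ^ n).
    + apply (cos_inversion_error v0 v1 (v1 + 1) h h1 h2 Hv0 Hv ltac:(lra)
               continuity_quotient Hd1 Hd2 Ch2 omega Hom C0 C3 n A); try easy.
      intros s Hs; apply (D3 s Hs).
    + apply Rmult_le_compat_r; [| lra].
      apply Rlt_le, Rinv_0_lt_compat; now apply pow_lt.
Qed.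

End Profile.

(** * Two-by-two complex matrices *)

Lemma mat2_entries (A : M2) : A = mat2 (entry A 0 0) (entry A 0 1) (entry A 1 0) (entry A 1 1).
Proof. now destruct A as [[a [b []]] [[c [d []]] []]]. Qed.

Lemma Mscal_mat2 (z a b c d : C) :
  Mscal z (mat2 a b c d) = mat2 (z * a)%C (z * b)%C (z * c)%C (z * d)%C.
Proof. reflexivity. Qed.

Lemma Mmul_mat2 (a b c d a' b' c' d' : C) :
  Mmul (mat2 a b c d) (mat2 a' b' c' d')
  = mat2 (a * a' + b * c')%C (a * b' + b * d')%C (c * a' + d * c')%C (c * b' + d * d')%C.
Proof.
  cbv [Mmul Mmult mk_matrix mk_Tn coeff_mat coeff_Tn mat2]; simpl Init.Nat.pred.
  now rewrite !sum_Sn, !sum_O.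
Qed.

Lemma Madd_mat2 (a b c d a' b' c' d' : C) :
  Madd (mat2 a b c d) (mat2 a' b' c' d')
  = mat2 (a + a')%C (b + b')%C (c + c')%C (d + d')%C.
Proof. reflexivity. Qed.

Lemma Msub_mat2 (a b c d a' b' c' d' : C) :
  Msub (mat2 a b c d) (mat2 a' b' c' d')
  = mat2 (a - a')%C (b - b')%C (c - c')%C (d - d')%C.
Proof. reflexivity. Qed.

Lemma Mid_mat2 : Mid = mat2 1 0 0 1.
Proof. reflexivity. Qed.

Lemma Cmod_le_1_norm (z : C) : Cmod z <= Rabs (fst z) + Rabs (snd z).
Proof.
  unfold Cmod; assert (H1 := Rabs_pos (fst z)); assert (H2 := Rabs_pos (snd z)).
  rewrite <- (sqrt_pow2 (Rabs (fst z) + Rabs (snd z))) by lra.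
  apply sqrt_le_1_alt; rewrite <- (pow2_abs (fst z)), <- (pow2_abs (snd z)); nra.
Qed.

Lemma op_norm_le_entries (a b c d : C) :
  op_norm (mat2 a b c d) <= Cmod a + Cmod b + Cmod c + Cmod d.
Proof.
  assert (Ha := Cmod_ge_0 a); assert (Hb := Cmod_ge_0 b).
  assert (Hc := Cmod_ge_0 c); assert (Hd := Cmod_ge_0 d).
  unfold op_norm.
  (* The upper bound excludes [p_infty]; the value [m_infty] would be sent by [real] to [0], still
     below the nonnegative bound. *)
  match goal with |- real (Lub_Rbar ?E) <= ?B =>
    assert (Hub : is_ub_Rbar E B); [| destruct (Lub_Rbar_correct E) as [_ Hlub];
      specialize (Hlub B Hub); destruct (Lub_Rbar E); simpl in *; [easy | easy | lra]] end.
  intros r (x & Hx & ->).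
  change (vec_norm (@Mmult C_Ring 2 2 1 (mat2 a b c d) x) <= Cmod a + Cmod b + Cmod c + Cmod d).
  destruct x as [[x0 []] [[x1 []] []]].
  unfold vec_norm in Hx; simpl coeff_mat in Hx.
  assert (H0 := Cmod_ge_0 x0); assert (H1 := Cmod_ge_0 x1).
  assert (Hsq : Cmod x0 ^ 2 + Cmod x1 ^ 2 = 1).
  { rewrite <- (sqrt_sqrt (Cmod x0 ^ 2 + Cmod x1 ^ 2)) by nra.
    change (sqrt (Cmod x0 ^ 2 + Cmod x1 ^ 2) = 1) in Hx; rewrite Hx; ring. }
  assert (B0 : Cmod x0 <= 1) by nra; assert (B1 : Cmod x1 <= 1) by nra.
  assert (Hrow : forall y z : C, Cmod (y * x0 + z * x1)%C <= Cmod y + Cmod z).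
  { intros y z; apply Rle_trans with (1 := Cmod_triangle _ _); rewrite !Cmod_mult.
    assert (Hy := Cmod_ge_0 y); assert (Hz := Cmod_ge_0 z); nra. }
  assert (E : vec_norm (@Mmult C_Ring 2 2 1 (mat2 a b c d) ((x0, tt), ((x1, tt), tt)))
    = sqrt (Cmod (a * x0 + b * x1)%C ^ 2 + Cmod (c * x0 + d * x1)%C ^ 2)).
  { unfold vec_norm; cbv [Mmult mk_matrix mk_Tn coeff_mat coeff_Tn mat2]; simpl Init.Nat.pred.
    now rewrite !sum_Sn, !sum_O. }
  apply Rle_trans with (1 := Req_le _ _ E).
  assert (R1 := Hrow a b); assert (R2 := Hrow c d).
  set (y := Cmod (a * x0 + b * x1)%C) in *; set (z := Cmod (c * x0 + d * x1)%C) in *.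
  assert (Hy : 0 <= y) by apply Cmod_ge_0; assert (Hz : 0 <= z) by apply Cmod_ge_0.
  apply Rle_trans with (y + z); [| lra].
  rewrite <- (sqrt_pow2 (y + z)) by lra; apply sqrt_le_1_alt; nra.
Qed.

(* Real and imaginary parts of [i^k]. *)
Fixpoint ipow (k : nat) : R * R :=
  match k with O => (1, 0) | S k => (- snd (ipow k), fst (ipow k)) end.

Lemma ipow_even_odd (k : nat) :
  ipow (2 * k) = ((-1) ^ k, 0) /\ ipow (2 * k + 1) = (0, (-1) ^ k).
Proof.
  assert (HS : forall k, ipow (S k) = (- snd (ipow k), fst (ipow k))) by reflexivity.
  induction k as [| k [IH1 IH2]]; [simpl; split; f_equal; ring |].
  replace (2 * S k)%nat with (S (2 * k + 1)) by lia.
  replace (S (2 * k + 1) + 1)%nat with (S (S (2 * k + 1))) by lia.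
  rewrite !HS, IH2; simpl; split; f_equal; ring.
Qed.

(** [cos] is defined by a power series in [x^2]. Interleaving it with the vanishing odd terms brings
    it to the shape of an exponential series, with [i^k] supplying signs and zeros. *)
Lemma is_series_cos (x : R) :
  is_series (fun k => / INR (fact k) * (x ^ k * fst (ipow k))) (cos x).
Proof.
  apply (is_series_ext (fun k => scal (pow_n x k) (fst (ipow k) / INR (fact k)))).
  { intros k; rewrite pow_n_pow; unfold scal; simpl; unfold mult; simpl.
    unfold Rdiv; ring. }
  replace (cos x) with (cos x + x * 0) by ring.
  apply (is_pseries_odd_even (fun k => fst (ipow k) / INR (fact k))).
  - unfold cos; destruct (exist_cos x²) as [l Hl]; apply is_series_Reals in Hl.
    apply (is_series_ext (fun n => cos_n n * x² ^ n)); [| exact Hl].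
    intros n; rewrite (proj1 (ipow_even_odd n)).
    apply (@eq_trans R _ ((x ^ 2) ^ n * ((-1) ^ n / INR (fact (2 * n))))).
    + rewrite <- Rsqr_pow2; unfold cos_n; ring.
    + exact (f_equal (fun y => y * _) (eq_sym (pow_n_pow (x ^ 2) n))).
  - apply (is_series_ext (fun _ => 0)).
    + intros n; rewrite (proj2 (ipow_even_odd n)); unfold scal; simpl; unfold mult; simpl.
      unfold Rdiv; ring.
    + apply is_series_Reals; intros e He; exists 0%nat; intros n _.
      unfold Rdist; replace (sum_f_R0 (fun _ => 0) n) with 0.
      * now rewrite Rminus_0_r, Rabs_R0.
      * induction n; simpl; lra.
Qed.

Lemma is_series_sin (x : R) :
  is_series (fun k => / INR (fact k) * (x ^ k * snd (ipow k))) (sin x).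
Proof.
  apply (is_series_ext (fun k => scal (pow_n x k) (snd (ipow k) / INR (fact k)))).
  { intros k; rewrite pow_n_pow; unfold scal; simpl; unfold mult; simpl.
    unfold Rdiv; ring. }
  unfold sin; destruct (exist_sin x²) as [l Hl]; apply is_series_Reals in Hl.
  replace (x * l) with (0 + x * l) by ring.
  apply (is_pseries_odd_even (fun k => snd (ipow k) / INR (fact k))).
  - apply (is_series_ext (fun _ => 0)).
    + intros n; rewrite (proj1 (ipow_even_odd n)); unfold scal; simpl; unfold mult; simpl.
      unfold Rdiv; ring.
    + apply is_series_Reals; intros e He; exists 0%nat; intros n _.
      unfold Rdist; replace (sum_f_R0 (fun _ => 0) n) with 0.
      * now rewrite Rminus_0_r, Rabs_R0.
      * induction n; simpl; lra.
  - apply (is_series_ext (fun n => sin_n n * x² ^ n)); [| exact Hl].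
    intros n; rewrite (proj2 (ipow_even_odd n)).
    apply (@eq_trans R _ ((x ^ 2) ^ n * ((-1) ^ n / INR (fact (2 * n + 1))))).
    + rewrite <- Rsqr_pow2; unfold sin_n; ring.
    + exact (f_equal (fun y => y * _) (eq_sym (pow_n_pow (x ^ 2) n))).
Qed.

(** [- i x sigma_y] is the real matrix of multiplication by [i x] on the complex plane, so its
    powers are read off from those of [i]. *)
Lemma Mexp_sigma_y (x : R) :
  Mexp (Mscal (Cmult (Copp Ci) (RtoC x)) sigma_y)
  = mat2 (RtoC (cos x)) (RtoC (- sin x)) (RtoC (sin x)) (RtoC (cos x)).
Proof.
  set (A := Mscal (Cmult (Copp Ci) (RtoC x)) sigma_y).
  assert (HA : A = mat2 0 (RtoC (- x)) (RtoC x) 0).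
  { unfold A, sigma_y; rewrite Mscal_mat2.
    f_equal; apply injective_projections; simpl; ring. }
  assert (Hpow : forall k, Mpow A k = mat2 (RtoC (x ^ k * fst (ipow k)))
     (RtoC (- (x ^ k * snd (ipow k)))) (RtoC (x ^ k * snd (ipow k))) (RtoC (x ^ k * fst (ipow k)))).
  { induction k as [| k IH].
    - change (Mpow A 0) with Mid; rewrite Mid_mat2; simpl.
      f_equal; apply injective_projections; simpl; ring.
    - change (Mpow A (S k)) with (Mmul A (Mpow A k)); rewrite IH, HA, Mmul_mat2.
      f_equal; apply injective_projections; simpl; ring. }
  assert (HS : forall a s, is_series a s ->
    CSeries (fun k => RtoC (a k)) = RtoC s).
  { intros a s Hs; unfold CSeries, RtoC; f_equal; simpl.
    - now apply is_series_unique.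
    - apply is_series_unique, is_series_Reals; intros e He; exists 0%nat; intros n _.
      unfold Rdist; replace (sum_f_R0 (fun _ => 0) n) with 0.
      + now rewrite Rminus_0_r, Rabs_R0.
      + induction n; simpl; lra. }
  assert (Hext : forall a b : nat -> C, (forall k, a k = b k) -> CSeries a = CSeries b).
  { intros a b Hab; unfold CSeries; f_equal; apply Series_ext; intros k; now rewrite Hab. }
  unfold Mexp; rewrite (mat2_entries (mk_matrix 2 2 _)).
  unfold entry at 1 3 5 7; rewrite !coeff_mat_bij by lia.
  f_equal.
  - rewrite <- (HS _ _ (is_series_cos x)); apply Hext; intros k.
    rewrite Hpow; apply injective_projections; simpl; ring.
  - assert (H : is_series (fun k => - (/ INR (fact k) * (x ^ k * snd (ipow k)))) (- sin x))
      by exact (is_series_opp _ _ (is_series_sin x)).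
    rewrite <- (HS _ _ H); apply Hext; intros k.
    rewrite Hpow; apply injective_projections; simpl; ring.
  - rewrite <- (HS _ _ (is_series_sin x)); apply Hext; intros k.
    rewrite Hpow; apply injective_projections; simpl; ring.
  - rewrite <- (HS _ _ (is_series_cos x)); apply Hext; intros k.
    rewrite Hpow; apply injective_projections; simpl; ring.
Qed.

(** * Real components of a solution *)

Lemma is_derive_C_components (F : R -> C) (t : R) (D : C) :
  @is_derive R_AbsRing C_R_NormedModule F t D ->
  is_derive (fun s => fst (F s)) t (fst D) /\ is_derive (fun s => snd (F s)) t (snd D).
Proof.
  intros H; split.
  - apply (filterdiff_comp' (V := C_R_NormedModule) (W := R_NormedModule)
             F fst t _ fst H).
    apply filterdiff_linear, (is_linear_fst (U := R_NormedModule) (V := R_NormedModule)).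
  - apply (filterdiff_comp' (V := C_R_NormedModule) (W := R_NormedModule)
             F snd t _ snd H).
    apply filterdiff_linear, (is_linear_snd (U := R_NormedModule) (V := R_NormedModule)).
Qed.

(* A solution is continuous on [[0, T]] only; composing it with [clamp] makes it
   continuous at every real, as [MVT_gen] requires at the endpoints. *)
Definition clamp (T t : R) : R := Rmax 0 (Rmin t T).

Lemma clamp_id (T t : R) : 0 <= t <= T -> clamp T t = t.
Proof. intros Ht; unfold clamp; rewrite Rmin_left, Rmax_right; lra. Qed.

Lemma clamp_range (T t : R) : 0 <= T -> 0 <= clamp T t <= T.
Proof.
  intros HT; unfold clamp; split; [apply Rmax_l |].
  apply Rmax_lub; [easy | apply Rmin_r].
Qed.

Lemma clamp_lipschitz (T x y : R) : Rabs (clamp T x - clamp T y) <= Rabs (x - y).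
Proof.
  unfold clamp, Rmax, Rmin, Rabs; repeat destruct Rle_dec; repeat destruct Rcase_abs; lra.
Qed.

Lemma continuous_clamp (F : R -> C) (T : R) : 0 <= T ->
  @continuous_on R_UniformSpace C_UniformSpace (fun t => 0 <= t <= T) F ->
  forall t, continuity_pt (fun t => fst (F (clamp T t))) t /\
            continuity_pt (fun t => snd (F (clamp T t))) t.
Proof.
  intros HT HF t.
  assert (H : filterlim (fun s => F (clamp T s)) (locally t) (locally (F (clamp T t)))).
  { apply (filterlim_comp _ _ _ (clamp T) F _ (within (fun t => 0 <= t <= T) (locally (clamp T t)))).
    - intros P [d Hd]; exists d; intros s Hs; apply Hd; [| now apply clamp_range].
      apply Rle_lt_trans with (2 := Hs); apply clamp_lipschitz.
    - apply (HF (clamp T t)); now apply clamp_range. }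
  split; apply continuity_pt_filterlim.
  - apply (filterlim_comp _ _ _ _ (fst : C -> R) _ _ _ H).
    apply (continuous_fst (U := R_UniformSpace) (V := R_UniformSpace)
             (fst (F (clamp T t))) (snd (F (clamp T t)))).
  - apply (filterlim_comp _ _ _ _ (snd : C -> R) _ _ _ H).
    apply (continuous_snd (U := R_UniformSpace) (V := R_UniformSpace)
             (fst (F (clamp T t))) (snd (F (clamp T t)))).
Qed.

(** The columns evolve independently. Dividing the equation by [i] and separating real and imaginary
    parts gives a real system to which the increment estimates apply. *)
Lemma solution_column (w T : R) (u v : R -> R) (X : R -> M2) (j : nat) :
  0 <= T -> (j < 2)%nat -> is_solution w u v T X ->
  exists (p q : R -> C) (l : list R),
    (forall t, 0 <= t <= T -> p t = entry (X t) 0 j /\ q t = entry (X t) 1 j) /\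
    (forall t, continuity_pt (fun t => fst (p t)) t /\ continuity_pt (fun t => snd (p t)) t /\
               continuity_pt (fun t => fst (q t)) t /\ continuity_pt (fun t => snd (q t)) t) /\
    forall t, 0 < t < T -> ~ In t l ->
      is_derive (fun t => fst (p t)) t (w * u t * snd (q t) - w * v t * fst (q t)) /\
      is_derive (fun t => snd (p t)) t (- (w * u t * fst (q t)) - w * v t * snd (q t)) /\
      is_derive (fun t => fst (q t)) t (w * u t * snd (p t) + w * v t * fst (p t)) /\
      is_derive (fun t => snd (q t)) t (- (w * u t * fst (p t)) + w * v t * snd (p t)).
Proof.
  intros HT Hj (_ & Hc & l & Hd).
  exists (fun t => entry (X (clamp T t)) 0 j), (fun t => entry (X (clamp T t)) 1 j), l.
  split; [intros t Ht; now rewrite clamp_id |]; split.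
  { intros t.
    destruct (continuous_clamp _ T HT (Hc 0%nat j ltac:(lia) Hj) t).
    destruct (continuous_clamp _ T HT (Hc 1%nat j ltac:(lia) Hj) t); easy. }
  intros t Ht Hn; destruct (Hd t Ht Hn) as (D & HD & Heq).
  rewrite clamp_id by lra.
  (* Near an interior point [clamp] is the identity, so the clamped entries keep their
     derivatives. *)
  assert (Hloc : locally t (fun s => 0 < s < T)).
  { apply filter_and; [now apply open_gt | now apply open_lt]. }
  assert (Hder : forall i, (i < 2)%nat ->
    is_derive (fun t => fst (entry (X (clamp T t)) i j)) t (fst (entry D i j)) /\
    is_derive (fun t => snd (entry (X (clamp T t)) i j)) t (snd (entry D i j))).
  { intros i Hi; apply is_derive_C_components.
    apply (is_derive_ext_loc (V := C_R_NormedModule) (fun s => entry (X s) i j)); [| now apply HD].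
    apply (filter_imp (fun s => 0 < s < T)); [| exact Hloc].
    intros s Hs; now rewrite clamp_id by lra. }
  destruct (Hder 0%nat ltac:(lia)) as [P1 P2]; destruct (Hder 1%nat ltac:(lia)) as [Q1 Q2].
  rewrite (mat2_entries D), (mat2_entries (X t)) in Heq.
  unfold sigma_x, sigma_y in Heq.
  rewrite !Mscal_mat2, Madd_mat2, Mscal_mat2, Mmul_mat2 in Heq.
  assert (E0 := f_equal (fun M => entry M 0 j) Heq).
  assert (E1 := f_equal (fun M => entry M 1 j) Heq); clear Heq.
  assert (F0 : (Ci * entry D 0 j)%C
    = (RtoC w * (RtoC (u t) * 1 + RtoC (v t) * - Ci) * entry (X t) 1 j)%C).
  { destruct j as [| [| j]]; [| | lia]; refine (eq_trans E0 _);
      generalize (entry (X t) 0 0) (entry (X t) 0 1) (entry (X t) 1 0) (entry (X t) 1 1);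
      intros; cbn; ring. }
  assert (F1 : (Ci * entry D 1 j)%C
    = (RtoC w * (RtoC (u t) * 1 + RtoC (v t) * Ci) * entry (X t) 0 j)%C).
  { destruct j as [| [| j]]; [| | lia]; refine (eq_trans E1 _);
      generalize (entry (X t) 0 0) (entry (X t) 0 1) (entry (X t) 1 0) (entry (X t) 1 1);
      intros; cbn; ring. }
  revert P1 P2 Q1 Q2 F0 F1; clear E0 E1.
  generalize (entry D 0 j) (entry D 1 j) (entry (X t) 0 j) (entry (X t) 1 j).
  intros d0 d1 p q P1 P2 Q1 Q2 F0 F1.
  assert (F0r := f_equal fst F0); assert (F0i := f_equal snd F0).
  assert (F1r := f_equal fst F1); assert (F1i := f_equal snd F1).
  clear F0 F1; simpl in F0r, F0i, F1r, F1i.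
  split; [| split; [| split]].
  - eapply is_derive_val; [exact P1 | lra].
  - eapply is_derive_val; [exact P2 | lra].
  - eapply is_derive_val; [exact Q1 | lra].
  - eapply is_derive_val; [exact Q2 | lra].
Qed.

(** * The propagator *)

(** The two families of intervals merge into one: piece [k], centred at [(2 k + 2) / eps], comes
    from the first family with [k = 2 m] and from the second with [k = 2 m + 1]. *)
Lemma controls_pieces (f : R -> R) (eps : R) (N : nat) (u v : R -> R) :
  0 < eps -> controls f eps N u v ->
  forall k t, (k < 2 * N)%nat ->
    (2 * INR k + 1) * (1 / eps) < t < (2 * INR k + 3) * (1 / eps) ->
    u t = (-1) ^ k /\ v t = pulse f N (t - (2 * INR k + 2) * (1 / eps)).
Proof.
  intros He (_ & H1 & H2 & _) k t Hk Ht.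
  destruct (Nat.Even_or_Odd k) as [[m ->] | [m ->]].
  - rewrite pow_1_even; rewrite mult_INR in *; simpl (INR 2) in *.
    replace ((2 * ((1 + 1) * INR m) + 2) * (1 / eps)) with ((4 * INR m + 2) / eps) by (field; lra).
    apply H1; [lia |].
    replace ((4 * INR m + 1) / eps) with ((2 * ((1 + 1) * INR m) + 1) * (1 / eps)) by (field; lra).
    replace ((4 * INR m + 3) / eps) with ((2 * ((1 + 1) * INR m) + 3) * (1 / eps)) by (field; lra).
    exact Ht.
  - replace (2 * m + 1)%nat with (S (2 * m)) in * by lia.
    rewrite pow_1_odd; rewrite S_INR, mult_INR in *; simpl (INR 2) in *.
    replace ((2 * ((1 + 1) * INR m + 1) + 2) * (1 / eps)) with ((4 * INR m + 4) / eps)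
      by (field; lra).
    apply H2; [lia |].
    replace ((4 * INR m + 3) / eps) with ((2 * ((1 + 1) * INR m + 1) + 1) * (1 / eps))
      by (field; lra).
    replace ((4 * INR m + 5) / eps) with ((2 * ((1 + 1) * INR m + 1) + 3) * (1 / eps))
      by (field; lra).
    exact Ht.
Qed.

Section Main.

Variables (v0 v1 : R) (f : R -> R) (n : nat).
Hypothesis Hv0 : 0 < v0.
Hypothesis Hv : v0 < v1.
Hypothesis Hf : Cc_infty f.
Hypothesis Hsupp : included (support f) (fun w => v0 <= w <= v1).

Let h (x : R) : R := f x / x.
Let H : R -> R := cos_transform (v1 + 1) h.

Variable M : R.
Hypothesis HC : 0 <= M.
Hypothesis HH : forall s, Rabs (H s) <= M / (1 + s ^ 2).
Hypothesis Hinv : forall A omega, 0 < A -> v0 <= omega <= v1 ->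
  Rabs (RInt (fun s => H s * cos (2 * omega * s)) 0 A - PI / 4 * h omega) <= M / A ^ n.

Variables (eps omega : R) (N : nat) (u v : R -> R) (X : R -> M2).
Hypothesis Heps : 0 < eps.
Hypothesis HN : (1 <= N)%nat.
Hypothesis Homega : v0 <= omega <= v1.
Hypothesis Hctrl : controls f eps N u v.
Let T := (4 * INR N + 2) / eps.
Hypothesis Hsol : is_solution omega u v T X.

(** The total angle: [2N] pieces, a factor [2] from evenness, and the coefficient [omega / (N PI)]
    of the drive. As [eps -> 0] the integral tends to [PI / 4 * h omega], so the angle tends to
    [omega * h omega = f omega]. *)
Let Phi := 4 * omega / PI * RInt (fun s => H s * cos (2 * omega * s)) 0 (1 / eps).

Lemma column_error (j : nat) (p0 q0 : R) : (j < 2)%nat ->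
  entry Mid 0 j = RtoC p0 -> entry Mid 1 j = RtoC q0 -> p0 ^ 2 + q0 ^ 2 = 1 ->
  let E := 224 * (v1 * M) ^ 2 / INR N in
  Rabs (fst (entry (X T) 0 j) - (cos Phi * p0 - sin Phi * q0)) <= E /\
  Rabs (snd (entry (X T) 0 j)) <= E /\
  Rabs (fst (entry (X T) 1 j) - (sin Phi * p0 + cos Phi * q0)) <= E /\
  Rabs (snd (entry (X T) 1 j)) <= E.
Proof.
  intros Hj Hp0 Hq0 Hn0 E.
  set (A := 1 / eps).
  assert (HA : 0 < A) by (apply Rdiv_lt_0_compat; lra).
  assert (HN' : 1 <= INR N) by now apply (le_INR 1).
  assert (HTA : T = (4 * INR N + 2) * A) by (unfold T, A; field; lra).
  assert (HT : 0 <= T) by (rewrite HTA; nra).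
  assert (HPI : 1 < PI) by (assert (P := PI2_1); lra).
  destruct (solution_column omega T u v X j HT Hj Hsol) as (p & q & l & Hpq & Hc & Hd).
  destruct (Hpq 0 ltac:(lra)) as [Hp Hq].
  destruct Hsol as [HX0 _]; rewrite HX0, Hp0 in Hp; rewrite HX0, Hq0 in Hq.
  set (qq := fun s => omega * pulse f N s).
  assert (Hqq : forall s, qq s = omega / (INR N * PI) * H s).
  { intros s; unfold qq; rewrite (pulse_cos_transform v0 v1) by easy.
    fold h; fold H; field; lra. }
  assert (CH : forall s, continuity_pt H s).
  { intros s; apply continuity_cos_transform.
    now apply (continuity_quotient v0 v1). }
  assert (Cqq : forall s, continuity_pt qq s).
  { intros s; apply (continuity_pt_ext (fun s => omega / (INR N * PI) * H s));
      [intros; now rewrite Hqq |].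
    apply continuity_pt_mult; [now apply continuity_pt_const | apply CH]. }
  assert (Eqq : forall s, qq (- s) = qq s).
  { intros s; rewrite !Hqq; f_equal; apply cos_transform_even. }
  set (Fc := fun s => qq s * cos (2 * omega * s)).
  set (Fs := fun s => qq s * sin (2 * omega * s)).
  assert (CFc : forall s, continuity_pt Fc s).
  { intros s; apply continuity_pt_mult; [easy | apply continuity_cos_lin]. }
  assert (CFs : forall s, continuity_pt Fs s).
  { intros s; apply continuity_pt_mult; [easy | apply continuity_sin_lin]. }
  assert (Hch : forall F, (forall s, continuity_pt F s) ->
    RInt F 0 A - RInt F 0 (- A) = RInt F (- A) A).
  { intros F HF.
    assert (E1 : RInt F (- A) 0 + RInt F 0 A = RInt F (- A) A)
      by (apply (RInt_Chasles (V := R_CompleteNormedModule)); now apply ex_RInt_continuity).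
    assert (E2 : - RInt F (- A) 0 = RInt F 0 (- A))
      by (apply (opp_RInt_swap (V := R_CompleteNormedModule)); now apply ex_RInt_continuity).
    lra. }
  assert (HQ : RInt Fs 0 (- A) = RInt Fs 0 A).
  { assert (D := Hch Fs CFs); rewrite (RInt_odd Fs A CFs) in D; [lra |].
    intros s; unfold Fs; rewrite Eqq, <- Ropp_mult_distr_r, sin_neg; ring. }
  assert (HPhi : INR (2 * N) * (RInt Fc 0 A - RInt Fc 0 (- A)) = Phi).
  { rewrite (Hch Fc CFc), (RInt_even Fc A CFc).
    2: { intros s; unfold Fc; now rewrite Eqq, <- Ropp_mult_distr_r, cos_neg. }
    assert (HFc : RInt Fc 0 A
      = omega / (INR N * PI) * RInt (fun s => H s * cos (2 * omega * s)) 0 A).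
    { set (k := omega / (INR N * PI)); set (J := RInt (fun s => H s * _) 0 A).
      replace (k * J) with (k * J + 0 * J) by ring.
      unfold J; rewrite <- RInt_lin
        by (intros s; apply continuity_pt_mult; [apply CH | apply continuity_cos_lin]).
      apply (RInt_ext (V := R_CompleteNormedModule)); intros s _.
      unfold Fc; rewrite Hqq; fold k.
      apply Rminus_diag_uniq; ring. }
    rewrite HFc, mult_INR; unfold Phi; fold A; simpl (INR 2); field; lra. }
  (* The decay of [H] bounds the drive by [K / (1 + s^2)], with primitive [K atan s]. *)
  set (K := omega * M / (INR N * PI)).
  assert (HK : 0 <= K).
  { apply Rmult_le_pos; [nra |]; apply Rlt_le, Rinv_0_lt_compat; nra. }
  set (g := fun s : R => K * / (1 + s²)).
  assert (HG : forall s, is_derive (fun s => K * atan s) s (g s)).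
  { intros s; apply is_derive_Rscal, is_derive_atan. }
  assert (Hqg : forall s, Rabs (qq s) <= g s).
  { intros s; rewrite Hqq, Rabs_mult, Rabs_pos_eq.
    - unfold g, K; replace (omega * M / (INR N * PI) * / (1 + s²))
        with (omega / (INR N * PI) * (M / (1 + s ^ 2))).
      + apply Rmult_le_compat_l; [| apply HH].
        apply Rmult_le_pos; [lra |]; apply Rlt_le, Rinv_0_lt_compat; nra.
      + rewrite Rsqr_pow2; assert (0 <= s ^ 2) by apply pow2_ge_0; field; nra.
    - apply Rmult_le_pos; [lra |]; apply Rlt_le, Rinv_0_lt_compat; nra. }
  assert (HphiD : Rabs (RInt Fc 0 A - RInt Fc 0 (- A)) <= K * atan A - K * atan (- A)).
  { apply (Rabs_increment_le (fun s => RInt Fc 0 s) (fun s => K * atan s) Fc g); [lra | | |].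
    - intros s _; now apply (is_derive_RInt_continuity Fc).
    - intros s _; apply HG.
    - intros s _; unfold Fc; rewrite Rabs_mult; apply Rle_trans with (2 := Hqg s).
      assert (E1 := Rabs_cos_le_1 (2 * omega * s)); assert (E2 := Rabs_pos (qq s)); nra. }
  destruct Hctrl as (U0 & _ & _ & U1).
  destruct (flow_total omega A N
      (fun t => fst (p t) + fst (q t)) (fun t => snd (p t) + snd (q t))
      (fun t => fst (p t) - fst (q t)) (fun t => snd (p t) - snd (q t))
      u v l qq (fun s => RInt Fc 0 s) (fun s => RInt Fs 0 s) (fun s => K * atan s) g)
    as (R1 & R2 & R3 & R4); try easy.
  - intros t; apply continuity_pt_plus; apply Hc.
  - intros t; apply continuity_pt_plus; apply Hc.
  - intros t; apply continuity_pt_minus; apply Hc.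
  - intros t; apply continuity_pt_minus; apply Hc.
  - rewrite <- HTA; intros t Ht Hn; destruct (Hd t Ht Hn) as (D1 & D2 & D3 & D4).
    split; [| split; [| split]].
    + eapply is_derive_val; [apply (is_derive_plus (fun t => fst (p t)) (fun t => fst (q t)));
        eassumption | unfold plus; simpl; ring].
    + eapply is_derive_val; [apply (is_derive_plus (fun t => snd (p t)) (fun t => snd (q t)));
        eassumption | unfold plus; simpl; ring].
    + eapply is_derive_val; [apply (is_derive_Rminus (fun t => fst (p t)) (fun t => fst (q t)));
        eassumption | ring].
    + eapply is_derive_val; [apply (is_derive_Rminus (fun t => snd (p t)) (fun t => snd (q t)));
        eassumption | ring].
  - rewrite Hp, Hq; simpl; lra.
  - rewrite <- HTA; intros t Ht; apply U1; unfold A in Ht; unfold T in *.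
    replace ((4 * INR N + 1) / eps) with ((4 * INR N + 2) / eps - 1 / eps) by (field; lra).
    exact Ht.
  - intros k t Hk Ht; destruct (controls_pieces f eps N u v Heps Hctrl k t Hk Ht) as [-> ->].
    now split.
  - intros s; now apply (is_derive_RInt_continuity Fc).
  - intros s; now apply (is_derive_RInt_continuity Fs).
  - rewrite HPhi, <- HTA, Hp, Hq in *; simpl fst in *; simpl snd in *.
    destruct (Hpq T ltac:(lra)) as [<- <-].
    (* The increment of [K atan] over [[- A, A]] is below [K PI = omega M / N] whatever [A] is. This
       is where the dependence on [eps] disappears. *)
    assert (HE : 224 * INR N * (K * atan A - K * atan (- A)) ^ 2 <= E).
    { rewrite atan_opp.
      assert (HatA := atan_bound A).
      assert (Hat0 : 0 < atan A) by (rewrite <- atan_0; now apply atan_increasing).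
      assert (HD : K * atan A - K * - atan A <= v1 * M / INR N).
      { apply Rle_trans with (K * PI); [nra |].
        replace (K * PI) with (omega * M / INR N) by (unfold K; field; lra).
        apply Rmult_le_compat_r; [apply Rlt_le, Rinv_0_lt_compat; lra | nra]. }
      assert (HD0 : 0 <= K * atan A - K * - atan A) by nra.
      apply Rle_trans with (224 * INR N * (v1 * M / INR N) ^ 2).
      - apply Rmult_le_compat_l; [lra | now apply pow_incr].
      - right; unfold E; field; lra. }
    set (E' := 224 * INR N * _) in *; clearbody E'.
    (* Returning from [p + q] and [p - q] to [p] and [q] takes half-sums and half-differences, so
       the error bound does not grow. *)
    apply Rabs_le_between in R1, R2, R3, R4.
    repeat split; apply Rabs_le; nra.
Qed.

(** The truncation point is [1 / eps], so a tail of order [A^(- n)] becomes [eps^n];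
    [4 omega / PI <= 4 v1] since [PI > 1]. *)
Lemma phase_error : Rabs (Phi - f omega) <= 4 * v1 * M * eps ^ n.
Proof.
  assert (HPI : 1 < PI) by (assert (P := PI2_1); lra).
  assert (HA : 0 < 1 / eps) by (apply Rdiv_lt_0_compat; lra).
  assert (HI := Hinv (1 / eps) omega HA Homega).
  set (J := RInt (fun s => H s * cos (2 * omega * s)) 0 (1 / eps)) in *.
  replace (Phi - f omega) with (4 * omega / PI * (J - PI / 4 * h omega))
    by (unfold Phi, h; fold J; field; lra).
  assert (He : 0 <= eps ^ n) by (apply pow_le; lra).
  replace (M / (1 / eps) ^ n) with (M * eps ^ n) in HI.
  2: { unfold Rdiv; rewrite Rmult_1_l, pow_inv, Rinv_inv; ring. }
  rewrite Rabs_mult.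
  replace (4 * v1 * M * eps ^ n) with ((4 * v1) * (M * eps ^ n)) by ring.
  apply Rmult_le_compat; try apply Rabs_pos; [| easy].
  rewrite Rabs_pos_eq.
  - apply Rle_div_l; nra.
  - apply Rmult_le_pos; [lra |]; apply Rlt_le, Rinv_0_lt_compat; lra.
Qed.

(** The phase error passes to the entries because [cos] and [sin] are 1-Lipschitz. The [8] counts
    four entries, each with a real and an imaginary part. *)
Lemma propagator_error :
  op_norm (Msub (X T) (Mexp (Mscal (Cmult (Copp Ci) (RtoC (f omega))) sigma_y)))
    <= 8 * (224 * (v1 * M) ^ 2 / INR N + 4 * v1 * M * eps ^ n).
Proof.
  rewrite Mexp_sigma_y, (mat2_entries (X T)), Msub_mat2.
  apply Rle_trans with (1 := op_norm_le_entries _ _ _ _).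
  destruct (column_error 0 1 0 ltac:(lia) eq_refl eq_refl ltac:(ring)) as (A1 & A2 & A3 & A4).
  destruct (column_error 1 0 1 ltac:(lia) eq_refl eq_refl ltac:(ring)) as (B1 & B2 & B3 & B4).
  assert (HP := phase_error).
  assert (Hc := Rle_trans _ _ _ (cos_lipschitz Phi (f omega)) HP).
  assert (Hs := Rle_trans _ _ _ (sin_lipschitz Phi (f omega)) HP).
  set (E := 224 * (v1 * M) ^ 2 / INR N) in *; set (d := 4 * v1 * M * eps ^ n) in *.
  assert (Hz : forall (z : C) (x x' y : R), Rabs (fst z - x) <= E -> Rabs (snd z) <= E ->
    Rabs (x' - y) <= d -> x = x' -> Cmod (z - RtoC y)%C <= 2 * (E + d)).
  { intros z x x' y H1 H2 H3 ->; apply Rle_trans with (1 := Cmod_le_1_norm _); simpl.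
    assert (T1 : Rabs (fst z + - y) <= E + d).
    { replace (fst z + - y) with ((fst z - x') + (x' - y)) by ring.
      apply Rle_trans with (1 := Rabs_triang _ _); lra. }
    rewrite Ropp_0, Rplus_0_r; assert (H4 := Rabs_pos (x' - y)); lra. }
  assert (Hs' : Rabs (- sin Phi - - sin (f omega)) <= d).
  { replace (- sin Phi - - sin (f omega)) with (- (sin Phi - sin (f omega))) by ring.
    now rewrite Rabs_Ropp. }
  assert (Z1 := Hz _ _ _ _ A1 A2 Hc ltac:(ring)).
  assert (Z2 := Hz _ _ _ _ A3 A4 Hs ltac:(ring)).
  assert (Z3 := Hz _ _ _ _ B1 B2 Hs' ltac:(ring)).
  assert (Z4 := Hz _ _ _ _ B3 B4 Hc ltac:(ring)).
  lra.
Qed.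

End Main.

Theorem theorem2p4 :
  forall (v0 v1 : R) (f : R -> R) (n : nat),
    0 < v0 -> v0 < v1 ->
    Cc_infty f ->
    included (support f) (fun w => v0 <= w <= v1) ->
    (1 <= n)%nat ->
    exists K : R, 0 < K /\
      forall (eps : R) (N : nat) (omega : R),
        0 < eps -> (1 <= N)%nat -> v0 <= omega <= v1 ->
        forall u v : R -> R, controls f eps N u v ->
        forall X : R -> M2,
          is_solution omega u v ((4 * INR N + 2) / eps) X ->
          op_norm (Msub (X ((4 * INR N + 2) / eps))
                        (Mexp (Mscal (Cmult (Copp Ci) (RtoC (f omega))) sigma_y)))
            <= K * (eps ^ n + / INR N).
Proof.
  intros v0 v1 f n Hv0 Hv Hf Hsupp Hn.
  destruct (cos_transform_constants v0 v1 f Hv0 Hv Hf Hsupp n Hn) as (C & HC & HH & Hinv).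
  assert (K1 : 0 <= (v1 * C) ^ 2) by apply pow2_ge_0.
  assert (K2 : 0 <= v1 * C) by nra.
  (* [1792 = 8 * 224] and [32 = 8 * 4]; the [1] makes the constant positive even when the others
     vanish. *)
  exists (1 + 1792 * (v1 * C) ^ 2 + 32 * (v1 * C)); split; [lra |].
  intros eps N omega Heps HN Homega u v Hctrl X Hsol.
  apply Rle_trans with (1 := propagator_error v0 v1 f n Hv0 Hv Hf Hsupp C HC HH Hinv
                               eps omega N u v X Heps HN Homega Hctrl Hsol).
  assert (He : 0 < eps ^ n) by now apply pow_lt.
  assert (HiN : 0 < / INR N) by (apply Rinv_0_lt_compat, lt_0_INR; lia).
  unfold Rdiv; nra.
Qed.
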